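(* Let $\phi:\mathbb{R}^n\to\mathbb{R}\cup\{\infty\}$ be proper, closed and $\lambda$-strongly convex with $\lambda\ge 0$. Suppose that $f(\cdot;s)$ is differentiable for all $s\in\mathcal{S}$ and that there exists $\beta\ge 0$ with $\mathbb{E}\|\nabla f(x;S)-\nabla f(x)\|^2\le\beta$ for all $x\in\mathbb{R}^n$. Let $f(\cdot;s)$ be convex for all $s\in\mathcal{S}$ and let $f$ be $L$-smooth. Let $x^\star=\arg\min_{x\in\mathbb{R}^n}\psi(x)$ and let $\theta>1$. Let $\{x^k\}_{k=0,\dots,K}$ be generated by the algorithm ProxSPS for step sizes $\alpha_k>0$ such that $$\alpha_k\le\frac{1-1/\theta}{L}.\qquad(\ast)$$ Then $$(1+\alpha_k\lambda)\,\mathbb{E}\|x^{k+1}-x^\star\|^2\le\mathbb{E}\|x^k-x^\star\|^2+2\alpha_k\,\mathbb{E}[\psi(x^\star)-\psi(x^{k+1})]+\theta\beta\alpha_k^2 .$$ Moreover: a) If $\lambda>0$ and $\alpha_k=\frac{1}{\lambda(k+k_0)}$ with $k_0\ge 1$ large enough such that $(\ast)$ is fulfilled, then $$\mathbb{E}\Big[\psi\Big(\tfrac1K\sum_{k=0}^{K-1}x^{k+1}\Big)-\psi(x^\star)\Big]\le\frac{\lambda k_0}{2K}\|x^0-x^\star\|^2+\frac{\theta\beta(1+\ln K)}{2\lambda K}.$$ b) If $\lambda=0$ and $\alpha_k=\frac{\alpha}{\sqrt{k+1}}$ with $\alpha\le\frac{1-1/\theta}{L}$, then $$\mathbb{E}\Big[\psi\Big(\tfrac{1}{\sum_{k=0}^{K-1}\alpha_k}\sum_{k=0}^{K-1}\alpha_kx^{k+1}\Big)-\psi(x^\star)\Big]\le\frac{\|x^0-x^\star\|^2}{4\alpha(\sqrt{K+1}-1)}+\frac{\theta\beta\alpha(1+\ln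 K)}{4(\sqrt{K+1}-1)}.$$ c) If $f$ is $\mu$-strongly convex with $\mu\ge 0$ (since every $f(\cdot;s)$ is convex, so is $f$; the value $\mu=0$ is allowed), and $\alpha_k=\alpha$ fulfilling $(\ast)$, then $$\mathbb{E}\|x^K-x^\star\|^2\le(1+\alpha(\mu+2\lambda))^{-K}\|x^0-x^\star\|^2+\frac{\theta\beta\alpha}{\mu+2\lambda}.$$
   Context: Setting. $S$ is a random variable with values in a sample space $\mathcal{S}$ and distribution $P$; $\mathbb{E}$ denotes expectation, $\mathbb{E}[X(S)]=\int_{\mathcal{S}}X(s)\,dP(s)$. For each $s\in\mathcal{S}$, $f(\cdot;s):\mathbb{R}^n\to\mathbb{R}$ is locally Lipschitz, and $f(x):=\mathbb{E}[f(x;S)]$ for $x\in\mathbb{R}^n$. For $\phi:\mathbb{R}^n\to\mathbb{R}\cup\{\infty\}$ put $\psi:=f+\phi$. For every $s\in\mathcal{S}$, $\inf_xf(x;s)$ is finite and a number $C(s)\le\inf_xf(x;s)$ is given. It is possible to generate infinitely many i.i.d. realizations of $S$. A function $h$ is $\lambda$-strongly convex, $\lambda\ge 0$, if $h-\frac{\lambda}{2}\|\cdot\|^2$ is convex; for $\lambda=0$ this means convex. A function $h:\mathbb{R}^n\to\mathbb{R}$ is $L$-smooth if it is differentiable and $\|\nabla h(x)-\nabla h(y)\|\le L\|x-y\|$ for all $x,y\in\mathbb{R}^n$. Algorithm ProxSPS. Given $x^0\in\mathbb{R}^n$ and step sizes $\alpha_k>0$, for $k=0,1,\dots,K-1$: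 draw $S_k\sim P$ (the draws being i.i.d.), set $g_k:=\nabla f(x^k;S_k)$ (in the general nondifferentiable version, choose $g_k\in\partial f(x^k;S_k)$, the subdifferential), and set $$x^{k+1}=\arg\min_{y\in\mathbb{R}^n}\ \max\{f(x^k;S_k)+\langle g_k,y-x^k\rangle,\,C(S_k)\}+\phi(y)+\frac{1}{2\alpha_k}\|y-x^k\|^2 .$$ *)

(* Defs.v *)
From HB Require Import structures.
From mathcomp Require Import all_boot all_order all_algebra.
From mathcomp Require Import all_classical all_reals all_analysis.

Set Implicit Arguments.
Unset Strict Implicit.
Unset Printing Implicit Defensive.

Import Order.TTheory GRing.Theory Num.Theory.
Import numFieldNormedType.Exports.

Local Open Scope classical_set_scope.
Local Open Scope ring_scope.

Section euclidean.
Context {R : realType} {n : nat}.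
Implicit Types (x y : 'rV[R]_n) (h : 'rV[R]_n -> \bar R) (f : 'rV[R]_n -> R).

Definition dotv x y : R := \sum_(i < n) x ord0 i * y ord0 i.

(* The library norm `|x| on 'rV_n is the sup norm; topology and
   differentiability do not depend on the choice, the quantities below do. *)
Definition enorm x : R := Num.sqrt (dotv x x).

Definition grad f x : 'rV[R]_n := \row_(i < n) 'D_(delta_mx ord0 i) f x.

Definition smooth (L : R) f : Prop :=
  (forall x, differentiable f x) /\
  (forall x y, enorm (grad f x - grad f y) <= L * enorm (x - y)).

Definition locally_lipschitz f : Prop :=
  forall x, exists2 U, nbhs x U & [lipschitz f y | y in U].

(* Meant for functions that never take the value -oo; in \bar R, 0 * +oo = 0. *)
Definition econvex h : Prop :=
  forall x y (t : R), 0 <= t <= 1 ->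
    (h (t *: x + (1 - t) *: y)%R <= t%:E * h x + (1 - t)%:E * h y)%E.

Definition strongly_convex (lambda : R) h : Prop :=
  econvex (fun x => (h x - (lambda / 2 * enorm x ^+ 2)%:E)%E).

Definition proper_efun h : Prop :=
  (forall x, h x != -oo%E) /\ (exists x, h x != +oo%E).

Definition closed_efun h : Prop :=
  closed [set p : 'rV[R]_n * R | (h p.1 <= p.2%:E)%E].

Definition is_argmin h x : Prop := forall y, (h x <= h y)%E.

End euclidean.

Section sampling.
Context {R : realType} {d dS : measure_display}.
Context {Omega : measurableType d} {T : measurableType dS}.

Definition mutually_independent (Pr : probability Omega R) (K : nat)
    (S : 'I_K -> {RV Pr >-> T}) : Prop :=
  forall (J : {set 'I_K}) (A : 'I_K -> set T), (forall k, measurable (A k)) ->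
    Pr (\bigcap_(k in [set` J]) S k @^-1` A k) =
    (\prod_(k in J) Pr (S k @^-1` A k))%E.

Definition iid (Pr : probability Omega R) (P : probability T R) (K : nat)
    (S : 'I_K -> {RV Pr >-> T}) : Prop :=
  mutually_independent S /\
  (forall k A, measurable A -> distribution Pr (S k) A = P A).

End sampling.

Section proxsps.
Context {R : realType} {n : nat} {dS : measure_display} {T : measurableType dS}.

Definition mean_fun (P : probability T R) (f : 'rV[R]_n -> T -> R) :
    'rV[R]_n -> R :=
  fun x => \int[P]_s f x s.

Definition composite (P : probability T R) (f : 'rV[R]_n -> T -> R)
    (phi : 'rV[R]_n -> \bar R) : 'rV[R]_n -> \bar R :=
  fun x => ((mean_fun P f x)%:E + phi x)%E.

Definition proxsps_objective (f : 'rV[R]_n -> T -> R) (C : T -> R)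
    (phi : 'rV[R]_n -> \bar R) (a : R) (x : 'rV[R]_n) (s : T) :
    'rV[R]_n -> \bar R :=
  fun y => ((Num.max (f x s + dotv (grad (f^~ s) x) (y - x)) (C s))%:E + phi y
            + (1 / (2 * a) * enorm (y - x) ^+ 2)%:E)%E.

(* Only the values x 0, ..., x K are constrained.  The argmin is unique for
   a > 0 and phi proper, closed and convex. *)
Definition proxsps {d : measure_display} {Omega : measurableType d}
    (Pr : probability Omega R) (K : nat) (S : 'I_K -> {RV Pr >-> T})
    (f : 'rV[R]_n -> T -> R) (C : T -> R) (phi : 'rV[R]_n -> \bar R)
    (alpha : nat -> R) (x0 : 'rV[R]_n) (x : nat -> Omega -> 'rV[R]_n) : Prop :=
  (forall w, x 0 w = x0) /\
  (forall (k : 'I_K) w,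
     is_argmin (proxsps_objective f C phi (alpha k) (x k w) (S k w))
               (x k.+1 w)).

End proxsps.

(* Main.v *)
Require Import Defs.
From HB Require Import structures.
From mathcomp Require Import all_boot all_order all_algebra.
From mathcomp Require Import all_classical all_reals all_analysis.
From mathcomp Require Import measurable_realfun.
From mathcomp Require Import ring lra.

Set Implicit Arguments.
Unset Strict Implicit.
Unset Printing Implicit Defensive.

Import Order.TTheory GRing.Theory Num.Theory.
Import numFieldNormedType.Exports.

Local Open Scope classical_set_scope.
Local Open Scope ring_scope.

(** The proof compares consecutive squared distances to the minimizer.

    At each step the objective minimized by the algorithm is (lambda + 1 / alpha_k)-strongly
    convex, so its value at xstar exceeds its minimum by a quadratic term
    ([prox_growth]).  At xstar the truncated linear model lies below f(xstar; S_k), by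
    convexity and because C is a lower bound; at the new iterate it lies above the
    linearization.  Replacing the drawn gradient by the mean gradient, bounding the
    mean function F at the new iterate by the descent lemma, and absorbing the gradient noise by Young's
    inequality gives, for every outcome,

      (1 + alpha_k lambda) |x_(k+1) - xstar|^2 + 2 alpha_k (psi x_(k+1) - psi xstar)
        <= |x_k - xstar|^2 + theta alpha_k^2 noise + 2 alpha_k deviation

    ([prox_step]), where the noise is the squared error of the drawn gradient at x_k
    and the deviation compares the errors of the drawn function at x_k and at xstar.

    Taking expectations requires that S_k be independent of x_k.  The law of the pair
    (past, S_k) is a product: this holds on the pi-system of events that constrain the
    draws before time k one by one, hence on the sigma-algebra it generates
    ([history_indep]).  Integrating S_k out first, the noise has mean at most beta
    and the deviation has mean zero ([noise_le_beta], [deviation_mean0]).  Two points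
    need care.
    - The iterates must be measurable with respect to the past.  They are only
      known as minimizers, but a minimizer depends continuously on the data of its step
      ([prox_stability]), and a function that is stable under small changes of finitely
      many measurable quantities is measurable ([measurable_stable]).
    - The deviation must be integrable.  It is bounded by the noise at x_k and at
      xstar and by the squared distance ([deviation_bound]); since the left-hand side
      above is a sum of nonnegative terms, square integrability of the distances
      propagates from one step to the next ([expected_step]).

    The three rates are consequences for sequences of real numbers: a) and b) add up
    weighted steps and use Jensen's inequality, with harmonic and inverse square root
    sums; c) adds the quadratic growth of psi at its minimizer and iterates a contraction. *)

(** * Euclidean inner product *)

Section inner_product.
Context {R : realType} {n : nat}.
Implicit Types (x y u v : 'rV[R]_n).

Lemma dotvC x y : dotv x y = dotv y x.
Proof. by apply: eq_bigr => i _; rewrite mulrC. Qed.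

Lemma dotvDl x y u : dotv (x + y) u = dotv x u + dotv y u.
Proof. by rewrite /dotv -big_split; apply: eq_bigr => i _; rewrite mxE mulrDl. Qed.

Lemma dotvNl x u : dotv (- x) u = - dotv x u.
Proof. by rewrite /dotv -sumrN; apply: eq_bigr => i _; rewrite mxE mulNr. Qed.

Lemma dotvBl x y u : dotv (x - y) u = dotv x u - dotv y u.
Proof. by rewrite dotvDl dotvNl. Qed.

Lemma dotvZl a x u : dotv (a *: x) u = a * dotv x u.
Proof. by rewrite /dotv mulr_sumr; apply: eq_bigr => i _; rewrite mxE mulrA. Qed.

Lemma dotvDr x y u : dotv u (x + y) = dotv u x + dotv u y.
Proof. by rewrite dotvC dotvDl !(dotvC u). Qed.

Lemma dotvNr x u : dotv u (- x) = - dotv u x.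
Proof. by rewrite dotvC dotvNl (dotvC u). Qed.

Lemma dotvBr x y u : dotv u (x - y) = dotv u x - dotv u y.
Proof. by rewrite dotvDr dotvNr. Qed.

Lemma dotvZr a x u : dotv u (a *: x) = a * dotv u x.
Proof. by rewrite dotvC dotvZl (dotvC u). Qed.

Lemma dotv_ge0 x : 0 <= dotv x x.
Proof. by apply: sumr_ge0 => i _; rewrite -expr2 sqr_ge0. Qed.

Lemma enorm_sqr x : enorm x ^+ 2 = dotv x x.
Proof. by rewrite sqr_sqrtr ?dotv_ge0. Qed.

Lemma dotv_le_coord x i : x ord0 i ^+ 2 <= dotv x x.
Proof.
rewrite /dotv (bigD1 i)//= -expr2 lerDl.
by apply: sumr_ge0 => j _; rewrite -expr2 sqr_ge0.
Qed.

Lemma dotv_sqrB x y : dotv (x - y) (x - y) = dotv (y - x) (y - x).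
Proof. by rewrite -opprB dotvNl dotvNr opprK. Qed.

Lemma dotv_convex_comb x y t :
  dotv (t *: x + (1 - t) *: y) (t *: x + (1 - t) *: y) =
  t * dotv x x + (1 - t) * dotv y y - t * (1 - t) * dotv (x - y) (x - y).
Proof.
rewrite !(dotvDl, dotvDr, dotvZl, dotvZr, dotvNl, dotvNr) (dotvC y x).
ring.
Qed.

(** Young's inequality, from the nonnegativity of the square of c u - v. *)
Lemma dotv_young c u v : 0 < c ->
  2 * dotv u v <= c * dotv u u + c^-1 * dotv v v.
Proof.
move=> c0.
have := dotv_ge0 (c *: u - v).
rewrite !(dotvDl, dotvDr, dotvZl, dotvZr, dotvNl, dotvNr) (dotvC v u) => h.
rewrite -subr_ge0 -(pmulr_rge0 _ c0).
apply: le_trans h _; rewrite le_eqVlt; apply/orP; left; apply/eqP.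
by field; rewrite gt_eqF.
Qed.

Lemma dotv_young1 u v : 2 * `|dotv u v| <= dotv u u + dotv v v.
Proof.
have := @dotv_young 1 u v ltr01; have := @dotv_young 1 (- u) v ltr01.
rewrite !(dotvNl, dotvNr) opprK invr1 !mul1r => h1 h2.
case: (ger0P (dotv u v)) => _; lra.
Qed.

End inner_product.

(** * Strong convexity *)

Section strong_convexity.
Context {R : realType} {n : nat}.
Implicit Types (x y z : 'rV[R]_n) (h : 'rV[R]_n -> \bar R) (F : 'rV[R]_n -> R).

(** Strong convexity read on the epigraph: upper bounds of the values are
    combined instead of the values, so that no arithmetic on infinite values
    occurs and adding a real-valued function is harmless. *)
Definition epi_sconvex (sigma : R) h : Prop :=
  forall x y a b t, 0 < t < 1 -> (h x <= a%:E)%E -> (h y <= b%:E)%E ->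
    (h (t *: x + (1 - t) *: y)%R <=
     (t * a + (1 - t) * b - sigma / 2 * (t * (1 - t) * dotv (x - y) (x - y)))%:E)%E.

Lemma strongly_convex_epi sigma h :
  strongly_convex sigma h -> epi_sconvex sigma h.
Proof.
move=> hc x y a b t /andP[t0 t1] ha hb.
have /hc : 0 <= t <= 1 by rewrite !ltW.
move=> /(_ x y); rewrite !enorm_sqr dotv_convex_comb => H.
rewrite -[h _](@subeK _ _ (sigma / 2 * (t * dotv x x + (1 - t) * dotv y y -
  t * (1 - t) * dotv (x - y) (x - y)))%:E)//.
apply: (@le_trans _ _ ((t * (a - sigma / 2 * dotv x x) +
   (1 - t) * (b - sigma / 2 * dotv y y))%:E +
   (sigma / 2 * (t * dotv x x + (1 - t) * dotv y y -
     t * (1 - t) * dotv (x - y) (x - y)))%:E)%E); last first.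
  by rewrite -EFinD lee_fin; lra.
apply: leeD => //.
apply: (le_trans H).
rewrite [leRHS]EFinD (EFinM t) (EFinM (1 - t)); apply: leeD.
  by apply: lee_wpmul2l; [rewrite lee_fin ltW|rewrite EFinB leeD2r].
by apply: lee_wpmul2l; [rewrite lee_fin subr_ge0 ltW|rewrite EFinB leeD2r].
Qed.

Lemma econvex_epi h : econvex h -> epi_sconvex 0 h.
Proof.
move=> hc; apply: strongly_convex_epi.
move=> x y t t01; rewrite !mul0r !sube0; exact: hc.
Qed.

Lemma epi_sconvexD s1 s2 F h :
  epi_sconvex s1 (EFin \o F) -> epi_sconvex s2 h ->
  epi_sconvex (s1 + s2) (fun x => (F x)%:E + h x)%E.
Proof.
move=> Fc hc x y a b t t01 ha hb.
have sub v c : ((F v)%:E + h v <= c%:E)%E -> (h v <= (c - F v)%:E)%E.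
  by rewrite EFinB leeBrDr// addeC.
have := hc _ _ _ _ _ t01 (sub _ _ ha) (sub _ _ hb).
have /= := Fc x y (F x) (F y) t t01 (lexx _) (lexx _).
rewrite lee_fin => F1 h1.
have := leeD (F1 : (_%:E <= _%:E)%E) h1.
move=> /le_trans; apply.
by rewrite -EFinD lee_fin; lra.
Qed.

Lemma epi_sconvex_le s1 s2 h : s1 <= s2 -> epi_sconvex s2 h -> epi_sconvex s1 h.
Proof.
move=> s12 hc x y a b t t01 ha hb; apply: le_trans (hc _ _ _ _ _ t01 ha hb) _.
have /andP[t0 t1] := t01.
rewrite lee_fin lerD2l lerN2 ler_wpM2r//; last by rewrite ler_pM2r// invr_gt0.
by rewrite mulr_ge0 ?dotv_ge0// mulr_ge0// ?subr_ge0 ltW.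
Qed.

Lemma epi_sconvex_sqr s x : epi_sconvex (2 * s) (fun y => (s * dotv (y - x) (y - x))%:E).
Proof.
move=> y z a b t /andP[t0 t1]; rewrite !lee_fin => ha hb.
have -> : t *: y + (1 - t) *: z - x = t *: (y - x) + (1 - t) *: (z - x).
  by apply/rowP => i; rewrite !mxE; ring.
rewrite dotv_convex_comb.
have -> : y - x - (z - x) = y - z by rewrite opprB addrA subrK.
have h1 := ler_wpM2l (ltW t0) ha.
have h2 : (1 - t) * _ <= _ := ler_wpM2l (_ : 0 <= 1 - t) hb.
rewrite subr_ge0 in h2; have {}h2 := h2 (ltW t1).
by lra.
Qed.

Lemma epi_sconvex_model c g x Cs :
  epi_sconvex 0 (fun y => (Num.max (c + dotv g (y - x)) Cs)%:E).
Proof.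
move=> y z a b t /andP[t0 t1]; rewrite !lee_fin !ge_max.
move=> /andP[ha1 ha2] /andP[hb1 hb2].
have -> : t *: y + (1 - t) *: z - x = t *: (y - x) + (1 - t) *: (z - x).
  by apply/rowP => i; rewrite !mxE; ring.
rewrite [dotv g _]dotvDr !dotvZr !mul0r subr0.
have t1' : 0 <= 1 - t by rewrite subr_ge0 ltW.
have h1 := ler_wpM2l (ltW t0) ha1.
have h2 := ler_wpM2l t1' hb1.
have h3 := ler_wpM2l (ltW t0) ha2.
have h4 := ler_wpM2l t1' hb2.
by apply/andP; split; lra.
Qed.

(** Quadratic growth: compare the minimum with the values on the segment from
    the minimizer to the other point, and let the segment shrink. *)
Lemma argmin_growth sigma h z y c b :
  epi_sconvex sigma h -> is_argmin h z -> h z = c%:E -> (h y <= b%:E)%E ->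
  c + sigma / 2 * dotv (y - z) (y - z) <= b.
Proof.
move=> hc zmin hz hy.
set q := sigma / 2 * _.
have key t : 0 < t < 1 -> (1 - t) * q <= b - c.
  move=> /[dup] t01 /andP[t0 t1].
  have hz' : (h z <= c%:E)%E by rewrite hz.
  have := hc _ _ _ _ _ t01 hy hz'.
  move=> /(le_trans (zmin _)); rewrite hz lee_fin => H.
  rewrite -subr_ge0 -(pmulr_rge0 _ t0) /q.
  by rewrite -subr_ge0 in H; lra.
rewrite -lerBrDl leNgt; apply/negP => lt.
have q0 : 0 <= `|q| by [].
(* Short enough a step for t * q to be less than the supposed gap. *)
pose t := Num.min (2^-1) ((q - (b - c)) / (2 * (`|q| + 1))).
have h0 : 0 < 2 * (`|q| + 1) by lra.
have t0 : 0 < t by rewrite /t lt_min; apply/andP; split; [lra|rewrite divr_gt0// subr_gt0].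
have t1 : t < 1 by rewrite /t gt_min; apply/orP; left; lra.
have := key t; rewrite t0 t1 => /(_ isT) K1.
have : t * (2 * (`|q| + 1)) <= q - (b - c).
  by rewrite -ler_pdivlMr// /t ge_min lexx orbT.
have : t * q <= t * `|q| by rewrite ler_pM2l// ler_norm.
have := mulr_ge0 (ltW t0) q0.
by lra.
Qed.

(** Jensen, with positive weights that need not sum to one; the induction
    merges the last point with the average of the others. *)
Lemma epi_jensen h (x : nat -> 'rV[R]_n) (r w : nat -> R) m : (0 < m)%N ->
  epi_sconvex 0 h -> (forall k, (k < m)%N -> 0 < w k) ->
  (forall k, (k < m)%N -> (h (x k) <= (r k)%:E)%E) ->
  (h ((\sum_(k < m) w k)^-1 *: \sum_(k < m) w k *: x k)%R <=
   ((\sum_(k < m) w k)^-1 * \sum_(k < m) w k * r k)%:E)%E.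
Proof.
case: m => // m _ hc; elim: m => [|m IH] w0 hr.
  have w00 := w0 0 (leqnn _).
  rewrite !big_ord_recl !big_ord0 !addr0 scalerA mulrA mulVf ?gt_eqF//.
  by rewrite scale1r mul1r; exact: hr.
have {}IH := IH (fun k km => w0 k (leqW km)) (fun k km => hr k (leqW km)).
rewrite !(big_ord_recr m.+1)/=.
set W := \sum_(k < m.+1) w k in IH *.
set X := \sum_(k < m.+1) w k *: x k in IH *.
set Y := \sum_(k < m.+1) w k * r k in IH *.
have wm := w0 _ (leqnn _).
have W0 : 0 < W.
  rewrite /W big_ord_recl ltr_pwDl ?w0//.
  by apply: sumr_ge0 => k _; rewrite ltW// w0// ltnS ltnW// ltnS.
have WW0 : 0 < W + w m.+1 by rewrite addr_gt0.
have t01 : 0 < W / (W + w m.+1) < 1.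
  by rewrite divr_gt0//= ltr_pdivrMr// mul1r ltrDl.
have := hc _ _ _ _ _ t01 IH (hr _ (leqnn _)).
have -> : 1 - W / (W + w m.+1) = w m.+1 / (W + w m.+1).
  by field; rewrite gt_eqF.
rewrite !mul0r subr0 !scalerA.
have -> : W / (W + w m.+1) / W = (W + w m.+1)^-1.
  by field; rewrite !gt_eqF.
have -> : W / (W + w m.+1) * (W^-1 * Y) + w m.+1 / (W + w m.+1) * r m.+1 =
   (W + w m.+1)^-1 * (Y + w m.+1 * r m.+1).
  by field; rewrite !gt_eqF.
by rewrite scalerDr scalerA [w _ / _]mulrC.
Qed.

End strong_convexity.

(** * First-order calculus *)

Section calculus.
Context {R : realType} {n : nat}.
Implicit Types (x y d : 'rV[R]_n) (F : 'rV[R]_n -> R).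

Lemma derive_dotv F x d : differentiable F x -> 'D_d F x = dotv (grad F x) d.
Proof.
move=> dF; rewrite (deriveE _ dF) {1}[d]row_sum_delta linear_sum.
apply: eq_bigr => i _; rewrite linearZ /= !mxE (deriveE _ dF).
by rewrite mulrC.
Qed.

Lemma derive1_line F x d t : differentiable F (x + t *: d) ->
  is_derive t 1 (fun s : R => F (x + s *: d)) (dotv (grad F (x + t *: d)) d).
Proof.
move=> dF; rewrite -derive_dotv//.
have e : (fun h : R => h^-1 *: (((fun s : R => F (x + s *: d)) \o shift t) (h *: 1)
     - F (x + t *: d))) =
   (fun h : R => h^-1 *: ((F \o shift (x + t *: d)) (h *: d) - F (x + t *: d))).
  apply/funext => h /=; congr (_ *: (F _ - _)).
  by rewrite scalerDl /GRing.scale/= mulr1 addrCA.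
have dd : derivable F (x + t *: d) d by exact: diff_derivable.
split; first by rewrite /derivable e; exact: dd.
by rewrite /derive e.
Qed.

(** Difference quotients of a convex function decrease to the directional
    derivative. *)
Lemma gradient_inequality F x y : epi_sconvex 0 (EFin \o F) ->
  differentiable F x -> F x + dotv (grad F x) (y - x) <= F y.
Proof.
move=> Fc dF; rewrite -lerBrDl -derive_dotv//.
have /cvg_dnbhs_at_right dd : derivable F x (y - x) by exact: diff_derivable.
rewrite /derive -(cvg_lim _ dd)//; apply: limr_le; first exact: cvgP dd.
have t1 : \forall t \near (0 : R)^'+, t < 1 by exact: nbhs_right_lt.
near=> t.
have t0 : 0 < t by near: t; exact: nbhs_right_gt.
have lt1 : t < 1 by near: t.
have := Fc y x (F y) (F x) t; rewrite t0 lt1 /= => /(_ isT (lexx _) (lexx _)).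
rewrite lee_fin => H.
rewrite /GRing.scale/= mulrC ler_pdivrMr//.
have -> : t *: (y - x) + x = t *: y + (1 - t) *: x.
  by apply/rowP => i; rewrite !mxE; ring.
by lra.
Unshelve. all: by end_near. Qed.

(** Along a segment, the gap to the quadratic bound has nonpositive derivative. *)
Lemma descent_lemma L F x y : 0 < L -> smooth L F ->
  F y <= F x + dotv (grad F x) (y - x) + L / 2 * dotv (y - x) (y - x).
Proof.
move=> L0 [dF gF].
set d := y - x; set q := dotv d d.
pose phi (t : R) := F (x + t *: d) - (t * dotv (grad F x) d + L / 2 * t ^+ 2 * q).
have q0 : 0 <= q by exact: dotv_ge0.
have dphi (t : R) : is_derive t 1 phi
    (dotv (grad F (x + t *: d)) d - (dotv (grad F x) d + L * t * q)).
  have h1 := derive1_line (dF (x + t *: d)).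
  apply: is_deriveB.
  apply: is_derive_eq.
  rewrite !scaler0 !add0r /GRing.scale/= !mulr1.
  by field.
have cphi : {within `[0, 1], continuous phi}.
  by apply: derivable_within_continuous => t _; exact: (@ex_derive _ _ _ _ _ _ _ (dphi t)).
have dle (t : R) : t \in `]0, 1[ -> derive1 phi t <= 0.
  rewrite in_itv/= => /andP[t0 _]; rewrite derive1E derive_val.
  have := gF (x + t *: d) x.
  have -> : x + t *: d - x = t *: d by rewrite addrAC subrr add0r.
  set u := _ - _ => Lu.
  have : enorm u ^+ 2 <= (L * enorm (t *: d)) ^+ 2.
    by rewrite ler_pXn2r// ?nnegrE ?mulr_ge0 ?sqrtr_ge0 ?ltW.
  rewrite exprMn !enorm_sqr dotvZl dotvZr -/q => Lu2.
  have Lt0 : 0 < (L * t)^-1 by rewrite invr_gt0 mulr_gt0.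
  have := dotv_young u d Lt0.
  rewrite invrK -/q.
  have := ler_wpM2l (ltW Lt0) Lu2.
  have -> : (L * t)^-1 * (L ^+ 2 * (t * (t * q))) = L * t * q.
    by field; rewrite !gt_eqF.
  have : dotv u d = dotv (grad F (x + t *: d)) d - dotv (grad F x) d by rewrite dotvBl.
  by lra.
have := @ler0_derive1_le_cc _ phi 0 1 (fun t _ => @ex_derive _ _ _ _ _ _ _ (dphi t)) dle cphi 1 0.
rewrite !in_itv/= !lexx ler01 => /(_ isT isT isT).
have -> : phi 0 = F x by rewrite /phi scale0r addr0 expr0n/=; ring.
have -> : phi 1 = F y - (dotv (grad F x) d + L / 2 * q).
  have xd : x + d = y by rewrite /d addrC subrK.
  by rewrite /phi scale1r xd; ring.
by lra.
Qed.

End calculus.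

(** * The proximal step *)

Section proximal_step.
Context {R : realType} {n : nat}.
Implicit Types (x y z g : 'rV[R]_n) (a c e L theta : R).
Variables (phi : 'rV[R]_n -> \bar R) (lambda : R).
Hypotheses (phi_proper : proper_efun phi) (phi_cvx : epi_sconvex lambda phi).

Definition model c g (Cs : R) x y : R := Num.max (c + dotv g (y - x)) Cs.

(** The objective of the algorithm with the drawn value, gradient and lower bound
    as free parameters, so that two draws can be compared. *)
Definition prox_objective c g Cs a x : 'rV[R]_n -> \bar R :=
  fun y => ((model c g Cs x y)%:E + phi y + (1 / (2 * a) * enorm (y - x) ^+ 2)%:E)%E.

Lemma addFinr_argmin_fin (F : 'rV[R]_n -> R) z :
  is_argmin (fun y => (F y)%:E + phi y)%E z -> phi z \is a fin_num.
Proof.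
case: phi_proper => pN [y py] zmin.
rewrite fin_numE pN/=; apply/eqP => pz.
have := zmin y; rewrite pz addeC addye// leye_eq.
by move: (pN y) py; case: (phi y).
Qed.

Lemma prox_objectiveE c g Cs a x :
  prox_objective c g Cs a x =
  (fun y => (model c g Cs x y + (2 * a)^-1 * dotv (y - x) (y - x))%:E + phi y)%E.
Proof.
apply/funext => y; rewrite /prox_objective enorm_sqr div1r.
by rewrite EFinD -!addeA; congr (_ + _)%E; rewrite addeC.
Qed.

Lemma prox_argmin_fin c g Cs a x z :
  is_argmin (prox_objective c g Cs a x) z -> phi z \is a fin_num.
Proof. by rewrite prox_objectiveE; exact: addFinr_argmin_fin. Qed.

(** The model is convex, phi contributes lambda and the proximal term 1 / a to the
    modulus of strong convexity. *)
Lemma prox_growth c g Cs a x z y : 0 < a ->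
  is_argmin (prox_objective c g Cs a x) z -> phi y \is a fin_num ->
  model c g Cs x z + fine (phi z) + (2 * a)^-1 * dotv (z - x) (z - x)
    + (lambda + a^-1) / 2 * dotv (y - z) (y - z)
  <= model c g Cs x y + fine (phi y) + (2 * a)^-1 * dotv (y - x) (y - x).
Proof.
move=> a0 zmin fy; have fz := prox_argmin_fin zmin.
rewrite prox_objectiveE in zmin.
pose F y := model c g Cs x y + (2 * a)^-1 * dotv (y - x) (y - x).
have Fc : epi_sconvex a^-1 (EFin \o F).
  have -> : a^-1 = 0 + 2 * (2 * a)^-1 by field; rewrite gt_eqF.
  have -> : EFin \o F = (fun y => (model c g Cs x y)%:E +
     ((2 * a)^-1 * dotv (y - x) (y - x))%:E)%E by [].
  apply: epi_sconvexD; first exact: epi_sconvex_model.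
  exact: epi_sconvex_sqr.
have := @argmin_growth _ _ _ _ z y (F z + fine (phi z)) (F y + fine (phi y))
  (epi_sconvexD Fc phi_cvx) zmin.
rewrite !EFinD !fineK// => /(_ erefl (lexx _)).
by rewrite /F; lra.
Qed.

(** The gradient noise is absorbed by Young's inequality with weight
    theta * a; what is left of the proximal term, (1 - 1 / theta) times
    the squared displacement, pays for the curvature of F. *)
Lemma prox_step c g Cs a x z xs F G L theta fs : 0 < a ->
  is_argmin (prox_objective c g Cs a x) z -> phi xs \is a fin_num ->
  0 < L -> 1 < theta -> a <= (1 - 1 / theta) / L ->
  c + dotv g (xs - x) <= fs -> Cs <= fs ->
  F z <= F x + dotv G (z - x) + L / 2 * dotv (z - x) (z - x) ->
  (1 + a * lambda) * dotv (z - xs) (z - xs)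
    + 2 * a * ((F z + fine (phi z)) - (F xs + fine (phi xs)))
  <= dotv (x - xs) (x - xs) + theta * a ^+ 2 * dotv (g - G) (g - G)
    + 2 * a * ((F x - c) - (F xs - fs)).
Proof.
move=> a0 zmin fxs L0 th1 aL cs Cls dF.
have th0 : 0 < theta by lra.
have := prox_growth a0 zmin fxs.
have m1 : c + dotv g (z - x) <= model c g Cs x z by rewrite /model le_max lexx.
have m2 : model c g Cs x xs <= fs by rewrite /model ge_max cs Cls.
rewrite (dotv_sqrB xs z) (dotv_sqrB xs x).
set A := dotv (z - xs) _; set B := dotv (x - xs) _.
set q := dotv (z - x) (z - x) in dF *.
have q0 : 0 <= q by exact: dotv_ge0.
set pz := fine (phi z); set ps := fine (phi xs).
have ta : 0 < theta * a by rewrite mulr_gt0.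
have Y := dotv_young (g - G) (x - z) ta.
rewrite (dotv_sqrB x z) -/q in Y.
have e : dotv (g - G) (x - z) = dotv G (z - x) - dotv g (z - x).
  by rewrite dotvBl !dotvBr; ring.
rewrite {}e in Y.
set N := dotv (g - G) _ in Y *.
have {}aL : a * L <= 1 - theta^-1 by rewrite -ler_pdivlMr// -[theta^-1]div1r.
have aLq := ler_wpM2r q0 aL.
move=> H.
have {}H := ler_wpM2l (ltW a0) H.
have {}Y := ler_wpM2l (ltW a0) Y.
have {}dF := ler_wpM2l (ltW a0) dF.
have {}m1 := ler_wpM2l (ltW a0) m1.
have {}m2 := ler_wpM2l (ltW a0) m2.
have e1 : a * (model c g Cs x z + pz + (2 * a)^-1 * q + (lambda + a^-1) / 2 * A)
  = a * model c g Cs x z + a * pz + q / 2 + (a * lambda + 1) / 2 * A.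
  by field; rewrite gt_eqF.
have e2 : a * (model c g Cs x xs + ps + (2 * a)^-1 * B)
  = a * model c g Cs x xs + a * ps + B / 2.
  by field; rewrite gt_eqF.
have e3 : a * (theta * a * N + (theta * a)^-1 * q) = theta * a ^+ 2 * N + theta^-1 * q.
  by field; rewrite !gt_eqF.
rewrite e1 e2 in H; rewrite e3 in Y.
lra.
Qed.

(** Replacing the data of the proximal step by nearby data moves the
    minimizer little: add the two growth inequalities, each tested at the
    minimizer of the other problem.  The data enter through the constant term
    at the origin c - <g, x>. *)
Lemma prox_stability a e c1 g1 C1 x1 z1 c2 g2 C2 x2 z2 : 0 < a -> 0 <= lambda ->
  is_argmin (prox_objective c1 g1 C1 a x1) z1 ->
  is_argmin (prox_objective c2 g2 C2 a x2) z2 ->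
  `|(c1 - dotv g1 x1) - (c2 - dotv g2 x2)| <= e -> `|C1 - C2| <= e ->
  (forall i, `|g1 ord0 i - g2 ord0 i| <= e) ->
  (forall i, `|x1 ord0 i - x2 ord0 i| <= e) ->
  dotv (z1 - z2) (z1 - z2) <=
    e * (a * (4 + 2 * \sum_(i < n) `|z1 ord0 i| + n%:R) + n%:R)
    + e * (a + 1) * dotv (z1 - z2) (z1 - z2).
Proof.
move=> a0 l0 h1 h2 dc dC dg dx.
have e0 : 0 <= e by apply: le_trans dC.
have f1 := prox_argmin_fin h1; have f2 := prox_argmin_fin h2.
have := prox_growth a0 h1 f2; have := prox_growth a0 h2 f1.
rewrite (dotv_sqrB z2 z1).
set q := dotv (z1 - z2) (z1 - z2).
have q0 : 0 <= q by exact: dotv_ge0.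
have hm y : `|model c1 g1 C1 x1 y - model c2 g2 C2 x2 y| <=
    2 * e + `|dotv (g1 - g2) y|.
  have -> : model c1 g1 C1 x1 y = Num.max ((c1 - dotv g1 x1) + dotv g1 y) C1.
    by rewrite /model dotvBr; congr (Num.max _ _); ring.
  have -> : model c2 g2 C2 x2 y = Num.max ((c2 - dotv g2 x2) + dotv g2 y) C2.
    by rewrite /model dotvBr; congr (Num.max _ _); ring.
  rewrite dotvBl; move: dc dC; rewrite !ler_norml => /andP[? ?] /andP[? ?].
  have := ler_norm (dotv g1 y - dotv g2 y).
  have := ler_norm (- (dotv g1 y - dotv g2 y)); rewrite normrN => ? ?.
  case: (leP _ C1) => ?; case: (leP _ C2) => ?; apply/andP; split; lra.
have hl (u y : 'rV[R]_n) : (forall i, `|u ord0 i| <= e) ->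
    `|dotv u y| <= e * \sum_(i < n) `|y ord0 i|.
  move=> hu; rewrite /dotv mulr_sumr; apply: le_trans (ler_norm_sum _ _ _) _.
  by apply: ler_sum => i _; rewrite normrM ler_wpM2r.
have hS : \sum_(i < n) `|(z1 - z2) ord0 i| <= n%:R + q.
  rewrite -[n in n%:R]card_ord -sumr_const /q /dotv -big_split.
  apply: ler_sum => i _ /=.
  move: ((z1 - z2) ord0 i : R) => v.
  have -> : v * v = `|v| ^+ 2 by rewrite real_normK ?num_real// expr2.
  have := sqr_ge0 (`|v| - 1); have := normr_ge0 v.
  by move: `|v| => t; rewrite sqrrB1; lra.
have hz2 : \sum_(i < n) `|z2 ord0 i| <= \sum_(i < n) `|z1 ord0 i| + (n%:R + q).
  apply: le_trans (lerD (lexx _) hS).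
  rewrite -big_split; apply: ler_sum => i _ /=; rewrite !mxE.
  by have := ler_normB (z1 ord0 i) (z1 ord0 i - z2 ord0 i); rewrite subKr.
have k1 : `|dotv (g1 - g2) z1| <= e * \sum_(i < n) `|z1 ord0 i|.
  by apply: hl => i; rewrite !mxE.
have k2 : `|dotv (g1 - g2) z2| <= e * (\sum_(i < n) `|z1 ord0 i| + (n%:R + q)).
  apply: (@le_trans _ _ (e * \sum_(i < n) `|z2 ord0 i|)).
    by apply: hl => i; rewrite !mxE.
  exact: ler_wpM2l.
have k3 : `|dotv (x1 - x2) (z1 - z2)| <= e * (n%:R + q).
  apply: (@le_trans _ _ (e * \sum_(i < n) `|(z1 - z2) ord0 i|)).
    by apply: hl => i; rewrite !mxE.
  exact: ler_wpM2l.
have := ler_norm (- (model c1 g1 C1 x1 z1 - model c2 g2 C2 x2 z1)).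
rewrite normrN => /le_trans/(_ (hm z1)) H1.
have := le_trans (ler_norm _) (hm z2) => H2.
have H3 := le_trans (ler_norm _) k3.
have e1 : dotv (z2 - x1) (z2 - x1) - dotv (z1 - x1) (z1 - x1)
  + dotv (z1 - x2) (z1 - x2) - dotv (z2 - x2) (z2 - x2)
  = 2 * dotv (x1 - x2) (z1 - z2).
  rewrite !(dotvBl, dotvBr) (dotvC z1 x1) (dotvC z2 x1) (dotvC z1 x2) (dotvC z2 x2).
  by ring.
move: e1 H1 H2 H3 k1 k2 => {hm hl hS hz2 k3 dc dC dg dx h1 h2}.
set S := \sum_(i < n) _.
set Q11 := dotv (z1 - x1) _; set Q21 := dotv (z2 - x1) _.
set Q12 := dotv (z1 - x2) _; set Q22 := dotv (z2 - x2) _.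
set M11 := model _ _ _ x1 z1; set M12 := model _ _ _ x1 z2.
set M21 := model _ _ _ x2 z1; set M22 := model _ _ _ x2 z2.
move=> e1 H1 H2 H3 k1 k2 G2 G1.
have lq : 0 <= lambda * q by rewrite mulr_ge0.
have G : a^-1 * q <= 4 * e + e * (2 * S + n%:R + q) + a^-1 * dotv (x1 - x2) (z1 - z2).
  have := lerD G1 G2.
  have : (2 * a)^-1 * (Q21 - Q11 + Q12 - Q22) = a^-1 * dotv (x1 - x2) (z1 - z2).
    by rewrite e1; field; rewrite gt_eqF.
  by lra.
have := ler_wpM2l (ltW a0) G.
rewrite !mulrDr !mulrA mulfV ?gt_eqF// !mul1r.
by lra.
Qed.

End proximal_step.

(** * Measurability *)

Section grid.
Context {R : realType} {d : measure_display} {X : measurableType d} {I : finType}.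
Variable p : I -> X -> R.
Hypothesis mp : forall i, measurable_fun setT (p i).

Definition cell (m : nat) (v : {ffun I -> int}) : set X :=
  [set w | forall i, Num.floor (m.+1%:R * p i w) = v i].

Lemma measurable_cell m v : measurable (cell m v).
Proof.
have -> : cell m v = \bigcap_(i in [set: I])
    (fun w => m.+1%:R * p i w) @^-1` `[(v i)%:~R, (v i + 1)%:~R[%classic.
  apply/seteqP; split => w /= h i.
    by move=> _; rewrite /= in_itv/= -floor_eq h.
  by apply/eqP; rewrite floor_eq; have := h i Logic.I; rewrite /= in_itv.
apply: fin_bigcap_measurable => // i _.
rewrite -[X in measurable X]setTI.
by apply: measurable_funM => //; exact: measurable_itv.
Qed.

Lemma cell_diam m v w w' i : cell m v w -> cell m v w' ->
  `|p i w - p i w'| < m.+1%:R^-1.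
Proof.
move=> /(_ i) + /(_ i); set x := p i w; set y := p i w' => hx hy.
have m0 : 0 < m.+1%:R :> R by [].
rewrite -(ltr_pM2l m0) mulfV ?gt_eqF// -[X in X * _]gtr0_norm// -normrM mulrBr.
have := floor_itv (m.+1%:R * x); have := floor_itv (m.+1%:R * y).
rewrite hx hy intrD; move=> /andP[? ?] /andP[? ?].
by rewrite ltr_norml; apply/andP; split; lra.
Qed.

(** A set described by a condition stable under small changes of finitely many
    measurable coordinates is the union of the cells that it contains, and
    there are countably many cells.  This handles maps, such as minimizers, that
    depend continuously on the coordinates but are only known along the range of p. *)
Lemma measurable_stable (A : set X) :
  (forall w, A w -> exists2 e : R, 0 < e &
     forall w', (forall i, `|p i w - p i w'| < e) -> A w') ->
  measurable A.
Proof.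
move=> hA.
have -> : A = \bigcup_(k : nat * {ffun I -> int})
    (if `[< cell k.1 k.2 `<=` A >] then cell k.1 k.2 else set0).
  apply/seteqP; split => [w Aw|w [[m v] _ /=]]; last first.
    by case: ifPn => // /asboolP; apply.
  have [e e0 he] := hA w Aw.
  have [m] := ltr_add_invr e0; rewrite add0r => em.
  exists (m, [ffun i => Num.floor (m.+1%:R * p i w)]) => //=.
  have cw : cell m [ffun i => Num.floor (m.+1%:R * p i w)] w by move=> i; rewrite ffunE.
  rewrite asboolT// => w' cw'; apply: he => i.
  exact: lt_trans (cell_diam i cw cw') em.
apply: countable_bigcupT_measurable; first exact: countableP.
by move=> [m v] /=; case: ifP => // _; exact: measurable_cell.
Qed.

Lemma measurable_fun_stable (y : X -> R) :
  (forall w (e : R), 0 < e -> exists2 e' : R, 0 < e' &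
     forall w', (forall i, `|p i w - p i w'| < e') -> `|y w - y w'| < e) ->
  measurable_fun setT y.
Proof.
move=> hy; apply: measurability (RGenOInfty.measurableE R) _.
move=> /= _ [_ [r ->] <-]; apply: measurable_stable.
move=> w [_]; rewrite /= in_itv/= andbT => rw.
have [|e e0 he] := hy w (y w - r); first by rewrite subr_gt0.
exists e => // w' /he; rewrite ltr_norml => /andP[_ hw'].
by split => //; rewrite /= in_itv/= andbT; lra.
Qed.

End grid.

Section random_vectors.
Context {R : realType} {n : nat} {d : measure_display} {X : measurableType d}.

(** Coordinatewise measurability: no sigma-algebra on vectors is fixed. *)
Definition vmeasurable (u : X -> 'rV[R]_n) : Prop :=
  forall i, measurable_fun setT (fun w => u w ord0 i).

Lemma vmeasurable_cst v : vmeasurable (fun=> v).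
Proof. by move=> i; exact: measurable_cst. Qed.

Lemma vmeasurableD u v : vmeasurable u -> vmeasurable v ->
  vmeasurable (fun w => u w + v w).
Proof. by move=> mu mv i; under eq_fun do rewrite mxE; exact: measurable_funD. Qed.

Lemma vmeasurableN u : vmeasurable u -> vmeasurable (fun w => - u w).
Proof.
move=> mu i; under eq_fun do rewrite mxE.
exact: measurableT_comp.
Qed.

Lemma vmeasurableZ u c : vmeasurable u -> vmeasurable (fun w => c *: u w).
Proof. by move=> mu i; under eq_fun do rewrite mxE; exact: measurable_funM. Qed.

Lemma vmeasurable_sum (I : Type) (s : seq I) (P : pred I) (u : I -> X -> 'rV[R]_n) :
  (forall i, vmeasurable (u i)) -> vmeasurable (fun w => \sum_(i <- s | P i) u i w).
Proof.
move=> mu; elim: s => [|i s IH].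
  by under eq_fun do rewrite big_nil; exact: vmeasurable_cst.
under eq_fun do rewrite big_cons.
by case: (P i) => //; exact: vmeasurableD.
Qed.

Lemma measurable_dotv u v : vmeasurable u -> vmeasurable v ->
  measurable_fun setT (fun w => dotv (u w) (v w)).
Proof. by move=> mu mv; apply: measurable_sum => i; exact: measurable_funM. Qed.

Lemma nbhs_rVP (x : 'rV[R]_n) (A : set 'rV[R]_n) :
  nbhs x A -> exists2 e : R, 0 < e &
    forall y : 'rV[R]_n, (forall i, `|x ord0 i - y ord0 i| < e) -> A y.
Proof.
move=> /nbhs_ballP[e e0 he]; exists e => // y hy; apply: he.
by split => // i j; rewrite (ord1 i); exact: hy.
Qed.

Lemma measurable_open_preimage u (U : set 'rV[R]_n) :
  vmeasurable u -> open U -> measurable (u @^-1` U).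
Proof.
move=> mu oU; apply: (measurable_stable mu) => w Uw.
have [e e0 he] := nbhs_rVP (open_nbhs_nbhs (conj oU Uw)).
by exists e => // w' hw'; exact: he.
Qed.

(** The epigraph is closed, so the superlevel sets are open. *)
Lemma measurable_closed_efun (h : 'rV[R]_n -> \bar R) u :
  closed_efun h -> vmeasurable u -> measurable_fun setT (h \o u).
Proof.
move=> hcl mu; apply: measurability (ErealGenOInfty.measurableE R) _.
move=> /= _ [_ [r ->] <-]; rewrite setTI.
have -> : (h \o u) @^-1` `]r%:E, +oo[%classic = u @^-1` [set v | (r%:E < h v)%E].
  by apply/seteqP; split => w /=; rewrite in_itv/= andbT.
apply: measurable_open_preimage => //.
have -> : [set v | (r%:E < h v)%E] = ~` ((fun v => (v, r)) @^-1`
    [set p : 'rV[R]_n * R | (h p.1 <= p.2%:E)%E]).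
  by apply/seteqP; split => v /=; rewrite ltNge => /negP.
apply: closed_openC; apply: closed_comp => // v _.
exact: (@cvg_pair _ _ _ (nbhs v) (nbhs v) (nbhs r) _ _ _ id _ cvg_id (cvg_cst r)).
Qed.

End random_vectors.

Section caratheodory.
Context {R : realType} {n : nat} {d dS : measure_display}.
Context {X : measurableType d} {T : measurableType dS}.
Variables (u : X -> 'rV[R]_n) (sig : X -> T) (h : 'rV[R]_n -> T -> R).
Hypotheses (mu : vmeasurable u) (msig : measurable_fun setT sig).
Hypothesis mh : forall v, measurable_fun setT (h v).

(** Composition with a function measurable in one variable and continuous in
    the other: round the continuous variable to a grid. *)
Lemma measurable_caratheodory : (forall s, continuous (h^~ s)) ->
  measurable_fun setT (fun w => h (u w) (sig w)).
Proof.
move=> ch.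
pose pt m (v : {ffun 'I_n -> int}) : 'rV[R]_n := \row_i ((v i)%:~R / m.+1%:R).
pose rd m w := [ffun i => Num.floor (m.+1%:R * u w ord0 i)].
apply: (@measurable_fun_cvg _ _ _ _ (fun m w => h (pt m (rd m w)) (sig w))).
  move=> m _ Y mY; rewrite setTI.
  have -> : (fun w => h (pt m (rd m w)) (sig w)) @^-1` Y =
      \bigcup_(v : {ffun 'I_n -> int}) (cell (fun i w => u w ord0 i) m v `&`
         sig @^-1` (h (pt m v) @^-1` Y)).
    apply/seteqP; split => [w /= Yw|w [v _ /= [cv Yw]]].
      by exists (rd m w) => //; split => // i; rewrite ffunE.
    suff -> : rd m w = v by [].
    by apply/ffunP => i; rewrite ffunE cv.
  apply: countable_bigcupT_measurable; first exact: countableP.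
  move=> v; apply: measurableI; first exact: measurable_cell.
  rewrite -[X in measurable X]setTI; apply: msig => //.
  by rewrite -[X in measurable X]setTI; exact: mh.
move=> w _.
apply: (cvg_comp (fun m => pt m (rd m w)) (h^~ (sig w)) _ (ch (sig w) (u w))).
apply/cvg_ballP => e e0; near=> m.
have em : m.+1%:R^-1 < e.
  near: m; have := @cvg_harmonic R => /cvgrPdist_lt/(_ _ e0).
  by apply: filterS => m; rewrite sub0r normrN ger0_norm ?harmonic_ge0.
split=> // i j; rewrite (ord1 i) /pt mxE /ball/= ffunE.
apply: lt_trans em.
have m0 : 0 < m.+1%:R :> R by [].
set x := u w _ _.
rewrite -(ltr_pM2l m0) mulfV ?gt_eqF// -[X in X * _]gtr0_norm// -normrM mulrBr.
rewrite mulrCA mulfV ?gt_eqF// mulr1.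
have /andP[] := floor_itv (m.+1%:R * x).
rewrite intrD => ? ?; rewrite ltr_norml; apply/andP; split; lra.
Unshelve. all: by end_near. Qed.

End caratheodory.

Section measurable_gradient.
Context {R : realType} {n : nat} {d dS : measure_display}.
Context {X : measurableType d} {T : measurableType dS}.

(** Partial derivatives are limits of difference quotients, to which
    measurable_caratheodory applies. *)
Lemma vmeasurable_grad (u : X -> 'rV[R]_n) (sig : X -> T) (h : 'rV[R]_n -> T -> R) :
  vmeasurable u -> measurable_fun setT sig ->
  (forall v, measurable_fun setT (h v)) -> (forall s v, differentiable (h^~ s) v) ->
  vmeasurable (fun w => grad (h^~ (sig w)) (u w)).
Proof.
move=> mu msig mh dh i; under eq_fun do rewrite mxE.
have ch s : continuous (h^~ s) by move=> v; exact: differentiable_continuous.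
pose q (m : nat) w := m.+1%:R * (h (m.+1%:R^-1 *: delta_mx ord0 i + u w) (sig w)
  - h (u w) (sig w)).
apply: (@measurable_fun_cvg _ _ _ _ q).
  move=> m; apply: measurable_funM => //; apply: measurable_funB.
    apply: (measurable_caratheodory _ msig mh ch).
    by apply: vmeasurableD => //; exact: vmeasurable_cst.
  exact: measurable_caratheodory.
move=> w _.
have dd : derivable (h^~ (sig w)) (u w) (delta_mx ord0 i) by exact: diff_derivable.
have [/(_ dd)/(_ harmonic) H _] := cvgr_dnbhsP
  (fun t : R => t^-1 *: (((h^~ (sig w)) \o shift (u w)) (t *: delta_mx ord0 i)
     - h (u w) (sig w))) 0 ('D_(delta_mx ord0 i) (h^~ (sig w)) (u w)).
have {H} := H (conj (fun m => lt0r_neq0 (harmonic_gt0 m)) cvg_harmonic).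
apply: cvg_trans; apply: near_eq_cvg; near=> m.
by rewrite /q /harmonic invrK.
Unshelve. all: by end_near. Qed.

End measurable_gradient.

Section measurable_prox.
Context {R : realType} {n : nat} {d : measure_display} {X : measurableType d}.

(** A minimizer chosen for each outcome is automatically measurable: by
    stability it moves little when the data of the step move little. *)
Lemma vmeasurable_prox (phi : 'rV[R]_n -> \bar R) (lambda a : R)
  (c Cs : X -> R) (g x z : X -> 'rV[R]_n) :
  proper_efun phi -> epi_sconvex lambda phi -> 0 <= lambda -> 0 < a ->
  measurable_fun setT c -> measurable_fun setT Cs -> vmeasurable g -> vmeasurable x ->
  (forall w, is_argmin (prox_objective phi (c w) (g w) (Cs w) a (x w)) (z w)) ->
  vmeasurable z.
Proof.
move=> pp pc l0 a0 mc mC mg mx zmin i.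
(* Changing the constant term of the affine model to its value at the origin makes
   the model at a fixed point depend linearly on the data. *)
pose p (j : bool + ('I_n + 'I_n)) (w : X) : R := match j with
  | inl true => c w - dotv (g w) (x w) | inl false => Cs w
  | inr (inl k) => g w ord0 k | inr (inr k) => x w ord0 k end.
apply: (@measurable_fun_stable _ _ _ _ p).
  case=> [[]|[k|k]] //=; last 2 first.
  - exact: mg.
  - exact: mx.
  by apply: measurable_funB => //; exact: measurable_dotv.
move=> w e e0.
set M := a * (4 + 2 * \sum_(i < n) `|z w ord0 i| + n%:R) + n%:R.
have M0 : 0 <= M.
  rewrite /M; apply: addr_ge0 => //; apply: mulr_ge0; first exact: ltW.
  by apply: addr_ge0 => //; apply: addr_ge0 => //; apply: mulr_ge0 => //; exact: sumr_ge0.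
(* The first bound lets the left-hand side of the stability estimate absorb its
   quadratic term, the second makes the remainder smaller than e ^ 2. *)
pose e' := Num.min (2 * (a + 1))^-1 (e ^+ 2 / (4 * (M + 1))).
have h1 : 0 < 2 * (a + 1) by lra.
have h2 : 0 < 4 * (M + 1) by lra.
have e'0 : 0 < e' by rewrite lt_min invr_gt0 h1 divr_gt0 ?exprn_gt0.
exists e' => // w' hw'.
have k1 : `|(c w - dotv (g w) (x w)) - (c w' - dotv (g w') (x w'))| <= e'.
  exact/ltW/(hw' (inl true)).
have k2 : `|Cs w - Cs w'| <= e' by exact/ltW/(hw' (inl false)).
have k3 k : `|g w ord0 k - g w' ord0 k| <= e' by exact/ltW/(hw' (inr (inl k))).
have k4 k : `|x w ord0 k - x w' ord0 k| <= e' by exact/ltW/(hw' (inr (inr k))).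
have := prox_stability pp pc a0 l0 (zmin w) (zmin w') k1 k2 k3 k4.
have := @dotv_le_coord _ _ (z w - z w') i; rewrite !mxE.
rewrite -/M; set q := dotv _ _; set t := z w ord0 i - _ => tq.
have q0 : 0 <= q by exact: dotv_ge0.
have l1 : e' * (2 * (a + 1)) <= 1.
  by rewrite -ler_pdivlMr// mul1r /e' ge_min lexx.
have l2 : e' * (4 * (M + 1)) <= e ^+ 2.
  by rewrite -ler_pdivlMr// /e' ge_min lexx orbT.
have l3 := ler_wpM2r q0 l1.
move=> l4.
have : `|t| ^+ 2 < e ^+ 2.
  by rewrite real_normK ?num_real//; lra.
by rewrite ltr_pXn2r ?nnegrE// ltW.
Qed.

End measurable_prox.

(** * Independence *)

Section independent_pair.
Context {R : realType} {d dY dT : measure_display}.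
Context {Omega : measurableType d} {Y : measurableType dY} {T : measurableType dT}.
Variables (Pr : probability Omega R) (P : probability T R).
Variables (X1 : {RV Pr >-> Y}) (X2 : {RV Pr >-> T}).
Hypothesis indep : forall A B, measurable A -> measurable B ->
  Pr (X1 @^-1` A `&` X2 @^-1` B) = (Pr (X1 @^-1` A) * P B)%E.

Let joint w := (X1 w, X2 w).

Let measurable_joint : measurable_fun setT joint.
Proof. by apply: measurable_fun_pair => //; exact: measurable_funPT. Qed.

HB.instance Definition _ := isMeasurableFun.Build _ _ _ _ joint measurable_joint.

Let joint_law A : measurable A ->
  (distribution Pr X1 \x P)%E A = pushforward Pr joint A.
Proof.
apply: (@product_measure_unique _ _ _ _ _ (distribution Pr X1) P (pushforward Pr joint)).
by move=> B C mB mC; rewrite -indep.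
Qed.

(** Independence makes the joint law a product, so the second variable can be
    integrated out first. *)
Lemma ge0_integral_indep (h : Y * T -> \bar R) :
  measurable_fun setT h -> (forall z, 0 <= h z)%E ->
  (\int[Pr]_w h (X1 w, X2 w) = \int[distribution Pr X1]_y \int[P]_s h (y, s))%E.
Proof.
move=> mh h0.
have := @ge0_integral_pushforward _ _ _ _ R _ measurable_joint Pr setT h measurableT mh
  (fun z _ => h0 z).
rewrite preimage_setT => <-.
rewrite -(@eq_measure_integral _ _ _ _ (pushforward Pr joint) (distribution Pr X1 \x P)%E);
  last by move=> A mA _; exact: joint_law.
by rewrite fubini_tonelli1.
Qed.

Lemma integral_indep (h : Y * T -> \bar R) :
  measurable_fun setT h -> Pr.-integrable setT (fun w => h (X1 w, X2 w)) ->
  (\int[Pr]_w h (X1 w, X2 w) = \int[distribution Pr X1]_y \int[P]_s h (y, s))%E.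
Proof.
move=> mh hi.
have hp : (pushforward Pr joint).-integrable setT h.
  by apply: integrable_pushforward.
rewrite -[LHS](@integral_pushforward _ _ _ _ R joint measurable_joint Pr setT h)//.
rewrite -(@eq_measure_integral _ _ _ _ (pushforward Pr joint) (distribution Pr X1 \x P)%E);
  last by move=> A mA _; exact: joint_law.
rewrite -integral12_prod_meas1//.
apply/integrableP; split => //.
rewrite (@eq_measure_integral _ _ _ _ (pushforward Pr joint) (distribution Pr X1 \x P)%E);
  last by move=> A mA _; exact: joint_law.
by case/integrableP: hp.
Qed.

End independent_pair.

Section history.
Context {R : realType} {d dT : measure_display}.
Context {Omega : measurableType d} {T : measurableType dT}.
Variables (Pr : probability Omega R) (P : probability T R) (K : nat).
Variable S : 'I_K -> {RV Pr >-> T}.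

(** The events describing the draws before time k by independent constraints;
    they are stable under intersection and generate the past. *)
Definition past (k : nat) : set (set Omega) :=
  [set B | exists2 A : 'I_K -> set T, (forall i, measurable (A i)) &
    B = \bigcap_(i in [set i : 'I_K | (i < k)%N]) S i @^-1` A i].

(** The sample space seen with the information of the past only. *)
Definition history k : measurableType _ := g_sigma_algebraType (past k).

Lemma past_measurable k : past k `<=` measurable.
Proof.
move=> _ [A mA ->]; apply: fin_bigcap_measurable; first exact: finite_finset.
by move=> i _; rewrite -[X in measurable X]setTI; exact: measurable_funPT.
Qed.

Lemma pastT k : past k setT.
Proof.
exists (fun=> setT) => //.
by apply/seteqP; split.
Qed.

Lemma pastI k : setI_closed (past k).
Proof.
move=> _ _ [A mA ->] [B mB ->]; exists (fun i => A i `&` B i).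
  by move=> i; exact: measurableI.
by rewrite -bigcapI; apply: eq_bigcapr => i _; rewrite preimage_setI.
Qed.

Definition to_history k : Omega -> history k := id.

Lemma measurable_to_history k : measurable_fun setT (to_history k).
Proof.
apply: (@measurability _ _ _ (history k) _ _ (past k)) => //.
by move=> _ [B pB <-]; rewrite setTI; exact: past_measurable pB.
Qed.

HB.instance Definition _ k :=
  isMeasurableFun.Build _ _ _ _ (to_history k) (@measurable_to_history k).

Lemma measurable_history_mono k l (kl : (k <= l)%N) :
  measurable_fun setT (id : history l -> history k).
Proof.
apply: (@measurability _ _ _ (history k) _ _ (past k)) => //.
move=> _ [_ [A mA ->] <-]; rewrite setTI.
apply: sub_sigma_algebra.
exists (fun i : 'I_K => if (i < k)%N then A i else setT).
  by move=> i; case: ifP.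
apply/seteqP; split => w /= h i /= il; first by case: ifP => // /h.
by have := h i (leq_trans il kl); rewrite il.
Qed.

Lemma measurable_history_draw (k : 'I_K) :
  measurable_fun setT (S k : history k.+1 -> T).
Proof.
move=> _ B mB; rewrite setTI; apply: sub_sigma_algebra.
exists (fun i => if i == k then B else setT); first by move=> i; case: ifP.
apply/seteqP; split => w /=; first by move=> h i /= _; case: eqP => [->|].
by move=> /(_ k (ltnSn k)); rewrite eqxx.
Qed.

Hypothesis S_iid : iid P S.

Lemma past_indep (k : 'I_K) A B : past k A -> measurable B ->
  Pr (A `&` S k @^-1` B) = (Pr A * P B)%E.
Proof.
case: S_iid => ind dist [A' mA' ->] mB.
pose J : {set 'I_K} := [set i : 'I_K | (i < k)%N]%SET.
have eJ : [set i : 'I_K | (i < k)%N]%classic = [set` J].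
  by apply/seteqP; split => i /=; rewrite inE.
rewrite eJ (ind J A' mA').
pose B' i := if i == k then B else A' i.
have mB' i : measurable (B' i) by rewrite /B'; case: ifP.
have kJ : k \notin J by rewrite inE ltnn.
have := ind (k |: J)%SET B' mB'.
rewrite (big_setU1 _ kJ)/= {1 2}/B' eqxx.
have -> : (\prod_(i in J) Pr (S i @^-1` B' i))%E = (\prod_(i in J) Pr (S i @^-1` A' i))%E.
  by apply: eq_bigr => i iJ; rewrite /B'; case: eqP => // ik; rewrite ik (negbTE kJ) in iJ.
have -> : \bigcap_(i in [set` (k |: J)%SET]) S i @^-1` B' i =
   \bigcap_(i in [set` J]) S i @^-1` A' i `&` S k @^-1` B.
  apply/seteqP; split => w /=.
    move=> h; split.
      move=> i /= iJ; have := h i; rewrite /= in_setU1 iJ orbT => /(_ isT).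
      by rewrite /B'; case: eqP => // ik; rewrite ik (negbTE kJ) in iJ.
    by have := h k; rewrite /= in_setU1 eqxx => /(_ isT); rewrite /B' eqxx.
  move=> [h hk] i /=; rewrite in_setU1 /B'; case: eqP => [-> _ //|_ /= iJ].
  exact: h.
by move=> ->; rewrite muleC -(dist k B mB).
Qed.

(** Independence passes from the generating events to the whole past. *)
Lemma history_indep (k : 'I_K) (A : set (history k)) (B : set T) :
  measurable A -> measurable B ->
  Pr (to_history k @^-1` A `&` S k @^-1` B) = (Pr (to_history k @^-1` A) * P B)%E.
Proof.
move=> mA mB.
have mSB : measurable (S k @^-1` B).
  by rewrite -[X in measurable X]setTI; exact: measurable_funPT.
have [p PBE] : exists p : {nonneg R}, P B = (p%:num)%:E.
  have PB0 : 0 <= fine (P B) by exact: fine_ge0.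
  by exists (NngNum PB0); rewrite /= fineK// fin_num_measure.
have H E : <<s past k >> E -> mrestr Pr mSB E = mscale p Pr E.
  apply: (@g_sigma_algebra_measure_unique _ R Omega (past k) (@past_measurable k)
    (fun=> setT) (fun=> pastT k)) => //.
  - by rewrite bigcup_const.
  - exact: pastI.
  - by move=> C pC; have := past_indep pC mB; rewrite muleC PBE.
  - move=> _; apply: (@le_lt_trans _ _ 1%E); last exact: ltry.
    by apply: probability_le1; exact: measurableI.
by rewrite muleC PBE; exact: (H A mA).
Qed.

End history.

(** * One step in expectation *)

Section real_integrals.
Context {R : realType} {d : measure_display} {Omega : measurableType d}.
Variable mu : {measure set Omega -> \bar R}.
Implicit Types u v : Omega -> R.

Definition rintegrable u : Prop := mu.-integrable setT (EFin \o u).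

Lemma rintegrable_measurable u : rintegrable u -> measurable_fun setT u.
Proof. by move=> /measurable_int/measurable_EFinP. Qed.

Lemma rintegrableD u v : rintegrable u -> rintegrable v ->
  rintegrable (fun w => u w + v w).
Proof. by move=> iu iv; have := integrableD measurableT iu iv. Qed.

Lemma rintegrableB u v : rintegrable u -> rintegrable v ->
  rintegrable (fun w => u w - v w).
Proof. by move=> iu iv; have := integrableB measurableT iu iv. Qed.

Lemma rintegrableZ c u : rintegrable u -> rintegrable (fun w => c * u w).
Proof. by move=> iu; have := integrableZl measurableT c iu. Qed.

Lemma rintegrable_dominated u v : measurable_fun setT u ->
  (forall w, `|u w| <= v w) -> rintegrable v -> rintegrable u.
Proof.
move=> mu' uv iv; apply: (le_integrable _ _ _ iv) => //; first exact/measurable_EFinP.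
by move=> w _; rewrite /= lee_fin; apply: le_trans (uv w) (ler_norm _).
Qed.

Lemma rintegrable_sum (I : Type) (s : seq I) (u : I -> Omega -> R) :
  (forall i, rintegrable (u i)) -> rintegrable (fun w => \sum_(i <- s) u i w).
Proof.
move=> iu; elim: s => [|i s IH].
  under eq_fun do rewrite big_nil.
  exact: integrable0.
by under eq_fun do rewrite big_cons; exact: rintegrableD.
Qed.

Lemma Rintegral_sum (I : Type) (s : seq I) (u : I -> Omega -> R) :
  (forall i, rintegrable (u i)) ->
  \int[mu]_w (\sum_(i <- s) u i w) = \sum_(i <- s) \int[mu]_w u i w.
Proof.
move=> iu; elim: s => [|i s IH].
  rewrite big_nil; under eq_Rintegral do rewrite big_nil.
  by rewrite Rintegral_cst// mul0r.
rewrite big_cons; under eq_Rintegral do rewrite big_cons.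
by rewrite (RintegralD measurableT (iu i) (rintegrable_sum s iu)) IH.
Qed.

Lemma integral_rintegrable u : rintegrable u ->
  (\int[mu]_w (u w)%:E)%E = (\int[mu]_w u w)%:E.
Proof. by move=> iu; rewrite fineK//; exact: integrable_fin_num iu. Qed.

End real_integrals.

Lemma Rintegral_probability_cst {R : realType} {d : measure_display}
  {T : measurableType d} (P : probability T R) (c : R) : \int[P]_(s in setT) c = c.
Proof. 
rewrite Rintegral_cst// -[RHS]mulr1; congr (c * _).
by rewrite -[1]/(fine 1%E); congr fine; exact: probability_setT.
 Qed.

Section mean_function.
Context {R : realType} {n : nat} {dS : measure_display} {T : measurableType dS}.
Variables (P : probability T R) (f : 'rV[R]_n -> T -> R).
Hypothesis f_int : forall y, P.-integrable setT (EFin \o f y).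

Lemma mean_fun_epi : (forall s, epi_sconvex 0 (EFin \o f^~ s)) ->
  epi_sconvex 0 (EFin \o mean_fun P f).
Proof.
move=> fc x y a b t t01 /=; rewrite !lee_fin !mul0r subr0 => Fa Fb.
have /andP[t0 t1] := t01.
apply: (@le_trans _ _ (t * mean_fun P f x + (1 - t) * mean_fun P f y)); last first.
  by apply: lerD; rewrite ler_pM2l// subr_gt0.
rewrite /mean_fun -!RintegralZl// -RintegralD//; last 2 first.
- exact: (rintegrableZ _ (f_int x)).
- exact: (rintegrableZ _ (f_int y)).
apply: (le_Rintegral measurableT (f_int _)
  (rintegrableD (rintegrableZ _ (f_int x)) (rintegrableZ _ (f_int y)))).
move=> s _; have := fc s x y (f x s) (f y s) t t01 (lexx _) (lexx _).
by rewrite /= lee_fin !mul0r subr0.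
Qed.

End mean_function.

Section expected_step.
Context {R : realType} {n : nat} {dS d : measure_display}.
Context {T : measurableType dS} {Omega : measurableType d}.
Variables (P : probability T R) (Pr : probability Omega R).
Variables (f : 'rV[R]_n -> T -> R) (C : T -> R) (phi : 'rV[R]_n -> \bar R).
Variables (lambda beta L theta : R) (xstar x0 : 'rV[R]_n).
Variables (K : nat) (S : 'I_K -> {RV Pr >-> T}) (alpha : nat -> R).
Variable x : nat -> Omega -> 'rV[R]_n.

Hypothesis f_int : forall y, P.-integrable setT (EFin \o f y).
Hypothesis C_meas : measurable_fun setT C.
Hypothesis C_le : forall s y, C s <= f y s.
Hypotheses (phi_proper : proper_efun phi) (phi_closed : closed_efun phi).
Hypotheses (lambda_ge0 : 0 <= lambda) (phi_cvx : epi_sconvex lambda phi).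
Hypothesis f_diff : forall s y, differentiable (f^~ s) y.
Hypothesis f_var : forall y,
  (\int[P]_s (enorm (grad (f^~ s) y - grad (mean_fun P f) y) ^+ 2)%:E <= beta%:E)%E.
Hypothesis f_cvx : forall s, epi_sconvex 0 (EFin \o f^~ s).
Hypotheses (L_gt0 : 0 < L) (f_smooth : smooth L (mean_fun P f)).
Hypothesis xstar_min : is_argmin (composite P f phi) xstar.
Hypothesis theta_gt1 : 1 < theta.
Hypothesis S_iid : iid P S.
Hypothesis alpha_gt0 : forall k : 'I_K, 0 < alpha k.
Hypothesis alpha_le : forall k : 'I_K, alpha k <= (1 - 1 / theta) / L.
Hypothesis x_algo : proxsps S f C phi alpha x0 x.

Local Notation F := (mean_fun P f).

Definition sqdist (k : nat) (w : Omega) : R := dotv (x k w - xstar) (x k w - xstar).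

(** A real number with meaning only where phi is finite, as it is at the iterates
    after the first and at their averages. *)
Definition excess (y : 'rV[R]_n) : R := (F y + fine (phi y)) - (F xstar + fine (phi xstar)).

Definition noise (y : 'rV[R]_n) (s : T) : R :=
  dotv (grad (f^~ s) y - grad F y) (grad (f^~ s) y - grad F y).

(** Both brackets have mean zero in s; subtracting the one at xstar makes the
    difference integrable along the iterates. *)
Definition deviation (y : 'rV[R]_n) (s : T) : R :=
  (F y - f y s) - (F xstar - f xstar s).

Lemma measurable_f y : measurable_fun setT (f y).
Proof. exact: rintegrable_measurable (f_int y). Qed.

Lemma continuous_f s : continuous (f^~ s).
Proof. by move=> y; exact: differentiable_continuous. Qed.

Lemma continuous_F : continuous F.
Proof. by move=> y; apply: differentiable_continuous; case: f_smooth. Qed.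

Lemma phi_xstar_fin : phi xstar \is a fin_num.
Proof. exact: (addFinr_argmin_fin phi_proper xstar_min). Qed.

Lemma phi_iterate_fin (k : 'I_K) w : phi (x k.+1 w) \is a fin_num.
Proof. by case: x_algo => _ /(_ k w); exact: prox_argmin_fin. Qed.

Lemma compositeE y : phi y \is a fin_num ->
  composite P f phi y = (F y + fine (phi y))%:E.
Proof. by move=> fy; rewrite /composite [RHS]EFinD (fineK fy). Qed.

Lemma excess_ge0 y : phi y \is a fin_num -> 0 <= excess y.
Proof.
move=> fy; have := xstar_min y.
by rewrite !compositeE ?phi_xstar_fin// lee_fin subr_ge0.
Qed.

Lemma history_iterate k : (k <= K)%N ->
  vmeasurable (x k : history S k -> 'rV[R]_n).
Proof.
case: x_algo => xE xmin.
elim: k => [|k IH] kK.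
  have -> : x 0%N = (fun=> x0) by apply/funext.
  exact: vmeasurable_cst.
pose i := Ordinal kK.
have mx : vmeasurable (x k : history S k.+1 -> 'rV[R]_n).
  move=> j; apply: (measurableT_comp (IH (ltnW kK) j)).
  exact: measurable_history_mono.
have mS := measurable_history_draw (S := S) (k := i).
apply: (@vmeasurable_prox _ _ _ (history S k.+1) phi lambda (alpha k) (fun w => f (x k w) (S i w))
  (fun w => C (S i w)) (fun w => grad (f^~ (S i w)) (x k w)) (x k)) => //.
- exact: (alpha_gt0 i).
- exact: (measurable_caratheodory mx mS measurable_f continuous_f).
- exact: (measurableT_comp C_meas mS).
- exact: (vmeasurable_grad mx mS measurable_f f_diff).
- by move=> w; exact: (xmin i w).
Qed.

Lemma vmeasurable_iterate k : (k <= K)%N -> vmeasurable (x k).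
Proof.
move=> kK j; apply: (measurableT_comp (history_iterate kK j)).
exact: measurable_to_history.
Qed.

Section data.
Context {dX : measure_display} {X : measurableType dX}.
Variables (u : X -> 'rV[R]_n) (sig : X -> T).
Hypotheses (mu : vmeasurable u) (msig : measurable_fun setT sig).

Lemma measurable_F : measurable_fun setT (fun w => F (u w)).
Proof.
apply: (@measurable_caratheodory _ _ _ _ _ _ u sig (fun y _ => F y)) => //.
by move=> _; exact: continuous_F.
Qed.

Lemma measurable_noise : measurable_fun setT (fun w => noise (u w) (sig w)).
Proof.
have m1 := vmeasurable_grad mu msig measurable_f f_diff.
have m2 : vmeasurable (fun w => grad F (u w)).
  apply: (@vmeasurable_grad _ _ _ _ _ _ u sig (fun y _ => F y)) => //.
  by move=> _; case: f_smooth.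
by apply: measurable_dotv; apply: vmeasurableD => //; exact: vmeasurableN.
Qed.

Lemma measurable_deviation : measurable_fun setT (fun w => deviation (u w) (sig w)).
Proof.
have m y : measurable_fun setT (fun w => f y (sig w)).
  exact: measurableT_comp (measurable_f y) msig.
apply: measurable_funB; apply: measurable_funB => //.
- exact: measurable_F.
- exact: (measurable_caratheodory mu msig measurable_f continuous_f).
Qed.

End data.

Lemma measurable_sqdist k : (k <= K)%N -> measurable_fun setT (sqdist k).
Proof.
move=> kK; have m := vmeasurable_iterate kK.
by apply: measurable_dotv; apply: vmeasurableD => //; exact: vmeasurable_cst.
Qed.

Lemma measurable_excess {dX} {X : measurableType dX} (u : X -> 'rV[R]_n) :
  vmeasurable u -> measurable_fun setT (fun w => excess (u w)).
Proof.
move=> mu; apply: measurable_funB => //; apply: measurable_funD.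
  apply: (@measurable_caratheodory _ _ _ _ _ _ u (fun=> point) (fun y (_ : T) => F y)) => //.
  by move=> _; exact: continuous_F.
apply: (@measurableT_comp _ _ _ _ _ _ fine _ (phi \o u)) => //.
exact: measurable_closed_efun.
Qed.

Section noise_moments.
Variables (k : 'I_K) (u : history S k -> 'rV[R]_n).
Hypothesis mu : vmeasurable u.

Let mu1 : vmeasurable (fun z : history S k * T => u z.1).
Proof. by move=> j; exact: (measurableT_comp (mu j) measurable_fst). Qed.

(** The draw is independent of the past, so conditionally on the past the
    noise at a past-measurable point has second moment at most beta. *)
Lemma noise_le_beta :
  (\int[Pr]_w (noise (u w) (S k w))%:E <= beta%:E)%E.
Proof.
pose h (z : history S k * T) := (noise (u z.1) z.2)%:E.
have mh : measurable_fun setT h.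
  apply/measurable_EFinP; exact: (measurable_noise mu1 measurable_snd).
have h0 z : (0 <= h z)%E by rewrite lee_fin dotv_ge0.
have := ge0_integral_indep (history_indep S_iid (k := k)) mh h0.
rewrite /h /= => ->.
rewrite -[leRHS]mule1 -(@probability_setT _ _ _ (distribution Pr (to_history S k))).
rewrite -integral_cst//.
apply: ge0_le_integral => //.
- by move=> y _; apply: integral_ge0 => s _; exact: (h0 (y, s)).
- exact: (@measurable_fun_fubini_tonelli_F _ _ _ _ R P h mh h0).
- by move=> y _; apply: le_trans (f_var (u y)); rewrite le_eqVlt; apply/orP; left;
    apply/eqP; apply: eq_integral => s _; rewrite enorm_sqr.
Qed.

Lemma rintegrable_noise : rintegrable Pr (fun w => noise (u w) (S k w)).
Proof.
apply/integrableP; split.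
  apply/measurable_EFinP; apply: measurable_noise; last exact: measurable_funPT.
  by move=> j; apply: (measurableT_comp (mu j)); exact: measurable_to_history.
under eq_integral do rewrite /= ger0_norm ?dotv_ge0//.
exact: le_lt_trans noise_le_beta (ltry _).
Qed.

Lemma deviation_mean0 : rintegrable Pr (fun w => deviation (u w) (S k w)) ->
  \int[Pr]_w deviation (u w) (S k w) = 0.
Proof.
pose h (z : history S k * T) := (deviation (u z.1) z.2)%:E.
have mh : measurable_fun setT h.
  apply/measurable_EFinP; exact: (measurable_deviation mu1 measurable_snd).
move=> hi; rewrite /Rintegral.
have -> := integral_indep (history_indep S_iid (k := k)) mh hi.
rewrite integral0_eq// => y _.
have ic c : rintegrable P (fun=> c).
  by apply: finite_measure_integrable_cst.
have i1 : rintegrable P (fun s => F (u y) - f (u y) s) by exact: rintegrableB (ic _) (f_int _).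
have i2 : rintegrable P (fun s => F xstar - f xstar s) by exact: rintegrableB (ic _) (f_int _).
rewrite /h /deviation /= (integral_rintegrable (rintegrableB i1 i2)).
rewrite (RintegralB measurableT i1 i2) !(RintegralB measurableT (ic _) (f_int _)).
by rewrite !Rintegral_probability_cst !subrr.
Qed.

End noise_moments.

(** Convexity of the drawn function and smoothness of the mean function control
    the deviation by the noise at both points, which makes it integrable. *)
Lemma deviation_bound y s :
  `|deviation y s| <= (noise xstar s + noise y s) / 2
     + (1 + L / 2) * dotv (y - xstar) (y - xstar).
Proof.
have h1 := descent_lemma xstar y L_gt0 f_smooth.
have h2 := descent_lemma y xstar L_gt0 f_smooth.
have h3 := gradient_inequality y (@f_cvx s) (f_diff s xstar).
have h4 := gradient_inequality xstar (@f_cvx s) (f_diff s y).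
rewrite (dotv_sqrB xstar y) in h2.
set q := dotv (y - xstar) (y - xstar) in h1 h2 *.
have q0 : 0 <= q by exact: dotv_ge0.
have := dotv_young1 (grad (f^~ s) xstar - grad F xstar) (y - xstar).
have := dotv_young1 (grad (f^~ s) y - grad F y) (xstar - y).
rewrite -/(noise y s) -/(noise xstar s) (dotv_sqrB xstar y) -/q.
rewrite (dotvBl _ (grad F y)) (dotvBl _ (grad F xstar)).
set A := dotv (grad (f^~ s) y) (xstar - y) in h4 *.
set B := dotv (grad F y) (xstar - y) in h2 *.
set A' := dotv (grad (f^~ s) xstar) (y - xstar) in h3 *.
set B' := dotv (grad F xstar) (y - xstar) in h1 *.
have := ler_norm (A - B); have := ler_norm (A' - B').
have := ler_norm (- (A - B)); have := ler_norm (- (A' - B')).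
rewrite !normrN => k1 k2 k3 k4 k5 k6.
have n1 : 0 <= noise y s by exact: dotv_ge0.
have n2 : 0 <= noise xstar s by exact: dotv_ge0.
rewrite /deviation.
clearbody A B A' B' q.
move: (F y) (F xstar) (f y s) (f xstar s) (noise y s) (noise xstar s)
  h1 h2 h3 h4 k1 k2 k3 k4 k5 k6 n1 n2.
move: `|A - B| `|A' - B'| => c c' Fy Fx fy fx ny nx h1 h2 h3 h4 k1 k2 k3 k4 k5 k6 n1 n2.
by rewrite ler_norml; apply/andP; split; lra.
Qed.

Lemma step_inequality (k : 'I_K) w :
  (1 + alpha k * lambda) * sqdist k.+1 w + 2 * alpha k * excess (x k.+1 w)
  <= sqdist k w + theta * alpha k ^+ 2 * noise (x k w) (S k w)
     + 2 * alpha k * deviation (x k w) (S k w).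
Proof.
case: x_algo => _ xmin.
apply: (prox_step phi_proper phi_cvx (alpha_gt0 k) (xmin k w) phi_xstar_fin L_gt0
  theta_gt1 (alpha_le k)).
- exact: (gradient_inequality _ (@f_cvx _) (f_diff _ _)).
- exact: C_le.
- exact: descent_lemma.
Qed.

(** In the pointwise inequality the right-hand side is integrable and the terms on
    the left are nonnegative, so these are integrable too and the expectations may be
    separated. *)
Lemma expected_step (k : 'I_K) : rintegrable Pr (sqdist k) ->
  [/\ rintegrable Pr (sqdist k.+1), rintegrable Pr (fun w => excess (x k.+1 w)) &
   (1 + alpha k * lambda) * \int[Pr]_w sqdist k.+1 w
     + 2 * alpha k * \int[Pr]_w excess (x k.+1 w)
   <= \int[Pr]_w sqdist k w + theta * beta * alpha k ^+ 2].
Proof.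
move=> ik.
have a0 := alpha_gt0 k.
have mxk := history_iterate (ltnW (ltn_ord k)).
have th0 : 0 < theta by exact: lt_trans theta_gt1.
have iN := rintegrable_noise mxk.
have iN' : rintegrable Pr (fun w => noise xstar (S k w)).
  exact: (rintegrable_noise (vmeasurable_cst xstar)).
have iD : rintegrable Pr (fun w => deviation (x k w) (S k w)).
  apply: (rintegrable_dominated (v := fun w => 2^-1 * (noise xstar (S k w)
     + noise (x k w) (S k w)) + (1 + L / 2) * sqdist k w)).
  - apply: measurable_deviation; last exact: measurable_funPT.
    exact/vmeasurable_iterate/ltnW.
  - by move=> w; apply: le_trans (deviation_bound _ _) _; rewrite [_ / 2]mulrC.
  - apply: rintegrableD; apply: rintegrableZ => //; exact: rintegrableD.
have D0 := deviation_mean0 mxk iD.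
have N0 : \int[Pr]_w noise (x k w) (S k w) <= beta.
  by rewrite -lee_fin -integral_rintegrable//; exact: noise_le_beta.
have i1 := rintegrableZ (theta * alpha k ^+ 2) iN.
have i2 := rintegrableZ (2 * alpha k) iD.
have i3 := rintegrableD ik i1.
have iB := rintegrableD i3 i2.
have s0 j w : 0 <= sqdist j w by exact: dotv_ge0.
have e0 w : 0 <= excess (x k.+1 w) by apply: excess_ge0; exact: phi_iterate_fin.
have m1 : measurable_fun setT (sqdist k.+1) by exact: measurable_sqdist.
have m2 : measurable_fun setT (fun w => excess (x k.+1 w)).
  by apply: measurable_excess; exact: vmeasurable_iterate.
have al0 : 0 <= alpha k * lambda by rewrite mulr_ge0// ltW.
have is1 : rintegrable Pr (sqdist k.+1).
  apply: rintegrable_dominated iB => // w; rewrite ger0_norm//.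
  apply: le_trans (step_inequality k w).
  have := mulr_ge0 al0 (s0 k.+1 w).
  have := mulr_ge0 (ltW a0) (e0 w); lra.
have ie : rintegrable Pr (fun w => excess (x k.+1 w)).
  apply: rintegrable_dominated (rintegrableZ (2 * alpha k)^-1 iB) => // w.
  rewrite ger0_norm// ler_pdivlMl; last by rewrite mulr_gt0.
  apply: le_trans (step_inequality k w).
  by rewrite lerDr mulr_ge0// addr_ge0.
split=> //.
have i4 := rintegrableZ (1 + alpha k * lambda) is1.
have i5 := rintegrableZ (2 * alpha k) ie.
rewrite -!RintegralZl//.
rewrite -(RintegralD measurableT i4 i5).
apply: le_trans (le_Rintegral measurableT (rintegrableD i4 i5) iB _) _.
  by move=> w _; exact: step_inequality.
rewrite (RintegralD measurableT i3 i2) (RintegralD measurableT ik i1).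
rewrite (RintegralZl _ measurableT iN) (RintegralZl _ measurableT iD) D0 mulr0 addr0.
have -> : theta * beta * alpha k ^+ 2 = theta * alpha k ^+ 2 * beta by ring.
rewrite lerD2l ler_wpM2l//.
by rewrite mulr_ge0// ?sqr_ge0// ltW.
Qed.

Lemma rintegrable_sqdist k : (k <= K)%N -> rintegrable Pr (sqdist k).
Proof.
elim: k => [_|k IH kK]; last first.
  by case: (@expected_step (Ordinal kK) (IH (ltnW kK))).
have [xE _] := x_algo.
have -> : sqdist 0 = fun=> dotv (x0 - xstar) (x0 - xstar).
  by apply/funext => w; rewrite /sqdist xE.
exact: finite_measure_integrable_cst.
Qed.

(** The moduli of strong convexity of the mean function and of phi add up. *)
Lemma excess_growth mu y : epi_sconvex mu (EFin \o F) -> phi y \is a fin_num ->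
  (mu + lambda) / 2 * dotv (y - xstar) (y - xstar) <= excess y.
Proof.
move=> Fc fy.
have fx := phi_xstar_fin.
have := argmin_growth (epi_sconvexD Fc phi_cvx) xstar_min (compositeE fx).
move=> /(_ y (F y + fine (phi y))); rewrite -compositeE// => /(_ (lexx _)).
by rewrite lerBrDl.
Qed.

Lemma integral_sqdist k : (k <= K)%N ->
  (\int[Pr]_w (enorm (x k w - xstar) ^+ 2)%:E)%E = (\int[Pr]_w sqdist k w)%:E.
Proof.
move=> kK; rewrite -(integral_rintegrable (rintegrable_sqdist kK)).
by apply: eq_integral => w _; rewrite enorm_sqr.
Qed.

Lemma integral_excess (k : 'I_K) :
  (\int[Pr]_w (composite P f phi xstar - composite P f phi (x k.+1 w)))%E
  = (- (\int[Pr]_w excess (x k.+1 w)))%:E.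
Proof.
have [_ ie _] := expected_step (rintegrable_sqdist (ltnW (ltn_ord k))).
have -> : - (\int[Pr]_w excess (x k.+1 w)) = (\int[Pr]_w (-1 * excess (x k.+1 w))).
  by rewrite RintegralZl// mulN1r.
rewrite -(integral_rintegrable (rintegrableZ _ ie)).
apply: eq_integral => w _.
rewrite (compositeE phi_xstar_fin) (compositeE (phi_iterate_fin k w)).
by rewrite -EFinB mulN1r opprB.
Qed.

(** By convexity the excess at the average, which is nonnegative, is dominated by
    the average of the excesses; this also makes it integrable. *)
Lemma expected_average (a : nat -> R) : (0 < K)%N -> (forall k, (k < K)%N -> 0 < a k) ->
  (\int[Pr]_w (composite P f phi
       ((\sum_(k < K) a k)^-1 *: \sum_(k < K) a k *: x k.+1 w)%R
     - composite P f phi xstar)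
   <= ((\sum_(k < K) a k)^-1 *
        \sum_(k < K) a k * \int[Pr]_w excess (x k.+1 w))%:E)%E.
Proof.
move=> K0 apos.
set W := \sum_(k < K) a k.
pose y w := W^-1 *: \sum_(k < K) a k *: x k.+1 w.
have Fc : epi_sconvex 0 (composite P f phi).
  rewrite -[0](addr0 0); apply: epi_sconvexD; first exact: mean_fun_epi.
  exact: epi_sconvex_le phi_cvx.
have jensen w : (composite P f phi (y w) <= (W^-1 * \sum_(k < K) a k *
    (F (x k.+1 w) + fine (phi (x k.+1 w))))%:E)%E.
  apply: (epi_jensen (x := fun k => x k.+1 w)
    (r := fun k => F (x k.+1 w) + fine (phi (x k.+1 w))) K0 Fc apos) => k kK.
  by rewrite (compositeE (phi_iterate_fin (Ordinal kK) w)).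
have fy w : phi (y w) \is a fin_num.
  have [pN _] := phi_proper; have := jensen w; rewrite /composite.
  by move: (pN (y w)); case: (phi (y w)).
have W0 : 0 < W.
  rewrite /W (bigD1 (Ordinal K0))//= ltr_pwDl ?apos//.
  by apply: sumr_ge0 => k _; rewrite ltW// apos.
pose U w := W^-1 * \sum_(k < K) a k * excess (x k.+1 w).
have ie (k : 'I_K) : rintegrable Pr (fun w => excess (x k.+1 w)).
  by case: (expected_step (rintegrable_sqdist (ltnW (ltn_ord k)))).
have is_ := rintegrable_sum (index_enum 'I_K) (fun k => rintegrableZ (a k) (ie k)).
have iU : rintegrable Pr U := rintegrableZ W^-1 is_.
have yU w : excess (y w) <= U w.
  have := jensen w; rewrite compositeE// lee_fin /excess /U => h.
  rewrite (eq_bigr (fun k : 'I_K => a k * (F (x k.+1 w) + fine (phi (x k.+1 w)))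
    - a k * (F xstar + fine (phi xstar)))); last by move=> k _; rewrite mulrBr.
  rewrite sumrB -mulr_suml -/W mulrBr mulKf ?gt_eqF//.
  by rewrite lerD2r.
have my : vmeasurable y.
  apply: vmeasurableZ; apply: vmeasurable_sum => k; apply: vmeasurableZ.
  exact: vmeasurable_iterate.
have iy : rintegrable Pr (fun w => excess (y w)).
  apply: rintegrable_dominated iU; first exact: measurable_excess.
  by move=> w; rewrite ger0_norm ?excess_ge0.
have -> : (\int[Pr]_w (composite P f phi (y w) - composite P f phi xstar))%E
   = (\int[Pr]_w excess (y w))%:E.
  rewrite -(integral_rintegrable iy); apply: eq_integral => w _.
  by rewrite (compositeE phi_xstar_fin) (compositeE (fy w)) -EFinB.
rewrite lee_fin; apply: le_trans (le_Rintegral measurableT iy iU _) _ => //.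
rewrite (RintegralZl _ measurableT is_) Rintegral_sum//; last first.
  by move=> k; exact: rintegrableZ (ie k).
rewrite le_eqVlt; apply/orP; left; apply/eqP; congr (_ * _).
by apply: eq_bigr => k _; exact: (RintegralZl _ measurableT (ie k)).
Qed.

End expected_step.

(** * Rates *)

Section rates.
Context {R : realType}.
Implicit Types (D G : nat -> R) (K : nat).

(** Induction on ln (k / (k + 1)) <= k / (k + 1) - 1. *)
Lemma sum_harmonic_le K : (0 < K)%N -> \sum_(k < K) (k%:R + 1)^-1 <= 1 + ln K%:R :> R.
Proof.
case: K => // K _; elim: K => [|K IH].
  by rewrite big_ord1 add0r invr1 ln1 addr0.
rewrite big_ord_recr/=.
have K0 : 0 < K.+1%:R :> R by [].
have K1 : 0 < K.+2%:R :> R by [].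
apply: le_trans (lerD IH (lexx _)) _.
rewrite -addrA lerD2l -lerBrDl.
have : ln (K.+1%:R / K.+2%:R : R) <= K.+1%:R / K.+2%:R - 1.
  have := @le_ln1Dx R (K.+1%:R / K.+2%:R - 1).
  have -> : 1 + (K.+1%:R / K.+2%:R - 1) = K.+1%:R / K.+2%:R :> R by ring.
  apply.
  by rewrite ltrBrDl subrr divr_gt0.
rewrite ln_div ?posrE//.
have -> : K.+1%:R / K.+2%:R - 1 = - (K.+1%:R + 1)^-1 :> R.
  rewrite -[K.+2%:R]natr1; field.
  by rewrite (nat1r K) natr1 gt_eqF.
lra.
Qed.

(** Concavity of the square root: sqrt (k + 2) - sqrt (k + 1) <= 1 / (2 sqrt (k + 1)). *)
Lemma sum_inv_sqrt_ge K :
  2 * (Num.sqrt (K%:R + 1) - 1) <= \sum_(k < K) (Num.sqrt (k%:R + 1))^-1 :> R.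
Proof.
elim: K => [|K IH]; first by rewrite big_ord0 add0r sqrtr1 subrr mulr0.
rewrite big_ord_recr/=; apply: le_trans (lerD IH (lexx _)).
set s := Num.sqrt (K%:R + 1); set t := Num.sqrt (K.+1%:R + 1).
have s0 : 0 < s by rewrite sqrtr_gt0 natr1.
have ss : s ^+ 2 = K%:R + 1 by rewrite sqr_sqrtr// natr1.
have tt : t ^+ 2 = K%:R + 2 by rewrite sqr_sqrtr ?natr1// -addn2 natrD.
have : 2 * s * (t - s) <= 1 by have := sqr_ge0 (t - s); nra.
rewrite -ler_pdivlMl ?mulr_gt0// invfM mulr1 => h.
lra.
Qed.

(** Each step trades decrease of u for g, up to the error v. *)
Lemma telescoping K (u g v : nat -> R) : 0 <= u K ->
  (forall k, (k < K)%N -> u k.+1 + g k <= u k + v k) ->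
  \sum_(k < K) g k <= u 0%N + \sum_(k < K) v k.
Proof.
move=> uK h.
suff: u K + \sum_(k < K) g k <= u 0%N + \sum_(k < K) v k by lra.
elim: K {uK} h => [|K IH] h; first by rewrite !big_ord0.
rewrite !big_ord_recr/=; have := h K (ltnSn K).
have := IH (fun k kK => h k (leqW kK)); lra.
Qed.

(** Multiplying the step by lambda (k + k0) / 2 makes the distances telescope,
    because (1 + alpha_k lambda) (k + k0) = k + 1 + k0; the errors become a harmonic sum. *)
Lemma rate_strongly_convex K D G lambda b k0 (alpha : nat -> R) :
  (0 < K)%N -> 0 < lambda -> 1 <= k0 -> 0 <= b -> (forall k, 0 <= D k) ->
  (forall k, (k < K)%N -> alpha k = 1 / (lambda * (k%:R + k0))) ->
  (forall k, (k < K)%N -> (1 + alpha k * lambda) * D k.+1 + 2 * alpha k * G k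
     <= D k + b * alpha k ^+ 2) ->
  K%:R^-1 * \sum_(k < K) G k
  <= lambda * k0 / (2 * K%:R) * D 0%N + b * (1 + ln K%:R) / (2 * lambda * K%:R).
Proof.
move=> K0 l0 k01 b0 D0 aE step.
have KR : 0 < K%:R :> R by rewrite ltr0n.
pose c (k : nat) : R := k%:R + k0.
have c0 k : 0 < c k.
  by rewrite /c; have : 0 <= k%:R :> R by []; move: (k%:R : R) => r; lra.
have := @telescoping K (fun k => lambda * c k / 2 * D k) G
  (fun k => b / (2 * lambda) * (c k)^-1).
have -> : c 0%N = k0 by rewrite /c add0r.
move=> /(_ _ _)/wrap[||H].
- by rewrite mulr_ge0// divr_ge0// mulr_ge0// ltW.
- move=> k kK; have := step k kK; rewrite (aE k kK) -/(c k) => h.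
  have lc : 0 < lambda * c k / 2 by rewrite divr_gt0// mulr_gt0.
  have := ler_wpM2l (ltW lc) h.
  have ck := c0 k.
  have -> : c k.+1 = c k + 1 by rewrite /c -natr1; ring.
  have -> : lambda * c k / 2 * ((1 + 1 / (lambda * c k) * lambda) * D k.+1
      + 2 * (1 / (lambda * c k)) * G k) = lambda * (c k + 1) / 2 * D k.+1 + G k.
    by field; rewrite !gt_eqF.
  have -> : lambda * c k / 2 * (D k + b * (1 / (lambda * c k)) ^+ 2)
    = lambda * c k / 2 * D k + b / (2 * lambda) * (c k)^-1.
    by field; rewrite !gt_eqF.
  by [].
have h1 : \sum_(k < K) (c k)^-1 <= 1 + ln K%:R :> R.
  apply: le_trans (sum_harmonic_le K0); apply: ler_sum => k _.
  have k1 : 0 < k%:R + 1 :> R by rewrite natr1.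
  by rewrite lef_pV2 ?posrE// lerD2l.
rewrite -mulr_sumr in H.
have bl : 0 <= b / (2 * lambda) by rewrite divr_ge0// mulr_ge0// ltW.
have := le_trans H (lerD (lexx _) (ler_wpM2l bl h1)).
move=> /(ler_wpM2l (_ : 0 <= K%:R^-1)); rewrite invr_ge0 => /(_ (ltW KR)).
move=> /le_trans; apply; rewrite le_eqVlt; apply/orP; left; apply/eqP.
by field; rewrite !gt_eqF.
Qed.

Lemma rate_convex K D G b a (alpha : nat -> R) :
  (0 < K)%N -> 0 < a -> 0 <= b -> (forall k, 0 <= D k) ->
  (forall k, (k < K)%N -> alpha k = a / Num.sqrt (k%:R + 1)) ->
  (forall k, (k < K)%N -> D k.+1 + 2 * alpha k * G k <= D k + b * alpha k ^+ 2) ->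
  (\sum_(k < K) alpha k)^-1 * \sum_(k < K) alpha k * G k
  <= D 0%N / (4 * a * (Num.sqrt (K%:R + 1) - 1))
     + b * a * (1 + ln K%:R) / (4 * (Num.sqrt (K%:R + 1) - 1)).
Proof.
move=> K0 a0 b0 D0 aE step.
have := @telescoping K D (fun k => 2 * alpha k * G k) (fun k => b * alpha k ^+ 2)
  (D0 K) step.
have -> : \sum_(k < K) 2 * alpha k * G k = 2 * \sum_(k < K) alpha k * G k.
  by rewrite mulr_sumr; apply: eq_bigr => k _; rewrite mulrA.
have -> : \sum_(k < K) b * alpha k ^+ 2 = b * a ^+ 2 * \sum_(k < K) (k%:R + 1)^-1.
  rewrite mulr_sumr; apply: eq_bigr => k _.
  by rewrite aE// expr_div_n sqr_sqrtr ?natr1// mulrA.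
have ba : 0 <= b * a ^+ 2 by rewrite mulr_ge0// sqr_ge0.
have := ler_wpM2l ba (sum_harmonic_le K0).
have -> : \sum_(k < K) alpha k = a * \sum_(k < K) (Num.sqrt (k%:R + 1))^-1.
  by rewrite mulr_sumr; apply: eq_bigr => k _; rewrite aE.
have := sum_inv_sqrt_ge K.
set s := Num.sqrt (K%:R + 1).
have s1 : 1 < s.
  have K1 : 1 < K%:R + 1 :> R by rewrite ltrDr ltr0n.
  by rewrite -[X in X < _]sqrtr1 ltr_sqrt// (lt_trans ltr01).
have l0 : 0 <= 1 + ln K%:R :> R by rewrite addr_ge0// ln_ge0// ler1n.
set W := \sum_(k < K) _^-1; set H := \sum_(k < K) (_ + _)^-1.
set Q := \sum_(k < K) _ * G k.
move=> Ws h1 h2.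
have {h1 h2} : 2 * Q <= D 0%N + b * a ^+ 2 * (1 + ln K%:R) by lra.
set B := D 0%N + _ => QB.
have B0 : 0 <= B by rewrite addr_ge0// mulr_ge0.
have W0 : 0 < W by apply: lt_le_trans Ws; rewrite mulr_gt0// subr_gt0.
have -> : D 0%N / (4 * a * (s - 1)) + b * a * (1 + ln K%:R) / (4 * (s - 1))
   = (2 * a * (s - 1))^-1 * (B / 2).
  by rewrite /B; field; rewrite !gt_eqF// subr_gt0.
apply: (@le_trans _ _ ((a * W)^-1 * (B / 2))).
  apply: ler_wpM2l; first by rewrite invr_ge0 mulr_ge0// ltW.
  lra.
rewrite ler_wpM2r ?divr_ge0// lef_pV2 ?posrE ?mulr_gt0 ?subr_gt0//.
by rewrite [2 * a]mulrC -mulrA ler_pM2l.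
Qed.

(** The constant e / (q - 1) is the fixed point of the map c |-> (c + e) / q. *)
Lemma rate_contraction K D q e : 1 < q -> 0 <= e ->
  (forall k, (k < K)%N -> q * D k.+1 <= D k + e) ->
  D K <= q ^- K * D 0%N + e / (q - 1).
Proof.
move=> q1 e0 step.
have q0 : 0 < q by exact: lt_trans q1.
have q10 : 0 < q - 1 by rewrite subr_gt0.
elim: K step => [|K IH] step; first by rewrite expr0 invr1 mul1r lerDl divr_ge0// ltW.
have {}IH := IH (fun k kK => step k (leqW kK)).
rewrite -(ler_pM2l q0); apply: le_trans (step K (ltnSn K)) _.
apply: le_trans (lerD IH (lexx _)) _.
rewrite le_eqVlt; apply/orP; left; apply/eqP.
rewrite exprS invfM.
by field; rewrite !gt_eqF// exprn_gt0.
Qed.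

End rates.

(** * Convergence of the iterates *)

Theorem theorem7 (R : realType) (n : nat)
  (dS : measure_display) (T : measurableType dS) (P : probability T R)
  (d : measure_display) (Omega : measurableType d) (Pr : probability Omega R)
  (f : 'rV[R]_n -> T -> R) (C : T -> R) (phi : 'rV[R]_n -> \bar R)
  (lambda beta L theta : R) (xstar x0 : 'rV[R]_n)
  (K : nat) (S : 'I_K -> {RV Pr >-> T}) (alpha : nat -> R)
  (x : nat -> Omega -> 'rV[R]_n)
  (f_lip : forall s, locally_lipschitz (f^~ s))
  (f_int : forall y, P.-integrable setT (EFin \o f y))
  (C_meas : measurable_fun setT C)
  (f_inf : forall s, has_inf (range (f^~ s)))
  (C_le : forall s, C s <= inf (range (f^~ s)))
  (phi_proper : proper_efun phi) (phi_closed : closed_efun phi)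
  (lambda_ge0 : 0 <= lambda) (phi_cvx : strongly_convex lambda phi)
  (f_diff : forall s y, differentiable (f^~ s) y)
  (beta_ge0 : 0 <= beta)
  (f_var : forall y,
     (\int[P]_s (enorm (grad (f^~ s) y - grad (mean_fun P f) y) ^+ 2)%:E
      <= beta%:E)%E)
  (f_cvx : forall s, econvex (EFin \o f^~ s))
  (L_gt0 : 0 < L) (f_smooth : smooth L (mean_fun P f))
  (xstar_min : is_argmin (composite P f phi) xstar)
  (theta_gt1 : 1 < theta)
  (S_iid : iid P S)
  (alpha_gt0 : forall k : 'I_K, 0 < alpha k)
  (alpha_le : forall k : 'I_K, alpha k <= (1 - 1 / theta) / L)
  (x_algo : proxsps S f C phi alpha x0 x) :
  let psi := composite P f phi in
  [/\ (forall k : 'I_K,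
         (1 + alpha k * lambda)%:E
           * \int[Pr]_w (enorm (x k.+1 w - xstar) ^+ 2)%:E
         <= \int[Pr]_w (enorm (x k w - xstar) ^+ 2)%:E
            + (2 * alpha k)%:E * \int[Pr]_w (psi xstar - psi (x k.+1 w))
            + (theta * beta * alpha k ^+ 2)%:E)%E,
      (forall k0 : R, (0 < K)%N -> 0 < lambda -> 1 <= k0 ->
         (forall k : 'I_K, alpha k = 1 / (lambda * (k%:R + k0))) ->
         (\int[Pr]_w (psi (K%:R^-1 *: \sum_(k < K) x k.+1 w)%R - psi xstar)
          <= (lambda * k0 / (2 * K%:R) * enorm (x0 - xstar) ^+ 2
              + theta * beta * (1 + ln K%:R) / (2 * lambda * K%:R))%:E)%E),
      (forall a : R, (0 < K)%N -> lambda = 0 -> a <= (1 - 1 / theta) / L ->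
         (forall k : 'I_K, alpha k = a / Num.sqrt (k%:R + 1)) ->
         (\int[Pr]_w (psi ((\sum_(k < K) alpha k)^-1
                             *: \sum_(k < K) alpha k *: x k.+1 w)%R - psi xstar)
          <= (enorm (x0 - xstar) ^+ 2 / (4 * a * (Num.sqrt (K%:R + 1) - 1))
              + theta * beta * a * (1 + ln K%:R)
                / (4 * (Num.sqrt (K%:R + 1) - 1)))%:E)%E)
    & (forall mu a : R, 0 <= mu ->
         strongly_convex mu (EFin \o mean_fun P f) ->
         0 < mu + 2 * lambda ->
         0 < a -> a <= (1 - 1 / theta) / L ->
         (forall k : 'I_K, alpha k = a) ->
         (\int[Pr]_w (enorm (x K w - xstar) ^+ 2)%:E
          <= ((1 + a * (mu + 2 * lambda)) ^- K * enorm (x0 - xstar) ^+ 2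
              + theta * beta * a / (mu + 2 * lambda))%:E)%E)].
Proof.
move=> psi.
have pc := strongly_convex_epi phi_cvx.
have fc s : epi_sconvex 0 (EFin \o f^~ s) by exact: econvex_epi.
have Cf s y : C s <= f y s.
  apply: le_trans (C_le s) _; apply: ge_inf; last by exists y.
  by case: (f_inf s).
pose D k := \int[Pr]_w sqdist xstar x k w.
pose G k := \int[Pr]_w excess P f phi xstar (x k.+1 w).
have sqdistE k : (k <= K)%N -> (\int[Pr]_w (enorm (x k w - xstar) ^+ 2)%:E)%E = (D k)%:E.
  exact: (integral_sqdist f_int C_meas Cf phi_proper phi_closed lambda_ge0 pc f_diff
    f_var fc L_gt0 f_smooth xstar_min theta_gt1 S_iid alpha_gt0 alpha_le x_algo).
have excessE (k : 'I_K) : (\int[Pr]_w (psi xstar - psi (x k.+1 w)))%E = (- G k)%:E.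
  exact: (integral_excess f_int C_meas Cf phi_proper phi_closed lambda_ge0 pc f_diff
    f_var fc L_gt0 f_smooth xstar_min theta_gt1 S_iid alpha_gt0 alpha_le x_algo).
have step (k : 'I_K) : [/\ rintegrable Pr (sqdist xstar x k.+1),
    rintegrable Pr (fun w => excess P f phi xstar (x k.+1 w)) &
    (1 + alpha k * lambda) * D k.+1 + 2 * alpha k * G k
      <= D k + theta * beta * alpha k ^+ 2].
  apply: (expected_step f_int C_meas Cf phi_proper phi_closed lambda_ge0 pc f_diff
    f_var fc L_gt0 f_smooth xstar_min theta_gt1 S_iid alpha_gt0 alpha_le x_algo).
  apply: (rintegrable_sqdist f_int C_meas Cf phi_proper phi_closed lambda_ge0 pc f_diff
    f_var fc L_gt0 f_smooth xstar_min theta_gt1 S_iid alpha_gt0 alpha_le x_algo).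
  exact: ltnW.
have average := expected_average f_int C_meas Cf phi_proper phi_closed lambda_ge0 pc f_diff
    f_var fc L_gt0 f_smooth xstar_min theta_gt1 S_iid alpha_gt0 alpha_le x_algo.
have step' k (kK : (k < K)%N) : (1 + alpha k * lambda) * D k.+1 + 2 * alpha k * G k
      <= D k + theta * beta * alpha k ^+ 2 by case: (step (Ordinal kK)).
have D_ge0 k : 0 <= D k by apply: Rintegral_ge0 => w _; exact: dotv_ge0.
have tb0 : 0 <= theta * beta by rewrite mulr_ge0// ltW// (lt_trans _ theta_gt1).
have D0E : D 0%N = enorm (x0 - xstar) ^+ 2.
  have [xE _] := x_algo.
  rewrite /D -[RHS](@Rintegral_probability_cst _ _ _ Pr) enorm_sqr.
  by apply: eq_Rintegral => w _; rewrite /sqdist xE.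
split.
- move=> k; rewrite sqdistE// sqdistE; last exact: ltnW.
  rewrite excessE -!EFinM -!EFinD lee_fin.
  by have := step' k (ltn_ord k); lra.
- move=> k0 K0 l0 k01 aE.
  have := average (fun=> 1) K0 (fun _ _ => ltr01).
  rewrite sumr_const card_ord.
  under eq_integral do under eq_bigr do rewrite scale1r.
  under eq_bigr do rewrite mul1r.
  move=> /le_trans; apply; rewrite lee_fin -D0E.
  by apply: (rate_strongly_convex K0 l0 k01 tb0 D_ge0 _ step') => k kK; exact: (aE (Ordinal kK)).
- move=> a K0 l0 _ aE.
  have a0 : 0 < a.
    have := alpha_gt0 (Ordinal K0); rewrite aE/= add0r sqrtr1 divr1; exact.
  apply: le_trans (average alpha K0 _) _; first by move=> k kK; exact: (alpha_gt0 (Ordinal kK)).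
  rewrite lee_fin -D0E.
  have aE' k (kK : (k < K)%N) : alpha k = a / Num.sqrt (k%:R + 1).
    exact: (aE (Ordinal kK)).
  have step0 k (kK : (k < K)%N) :
      D k.+1 + 2 * alpha k * G k <= D k + theta * beta * alpha k ^+ 2.
    by have := step' k kK; rewrite l0 mulr0 addr0 mul1r.
  exact: (rate_convex K0 a0 tb0 D_ge0 aE' step0).
- move=> mu a mu0 Fc ml0 a0 _ aE.
  have Fe := strongly_convex_epi Fc.
  have growth (k : 'I_K) : (mu + lambda) / 2 * D k.+1 <= G k.
    have [is1 ie _] := step k.
    rewrite -(RintegralZl _ measurableT is1).
    apply: (le_Rintegral measurableT (rintegrableZ _ is1) ie) => w _.
    apply: (excess_growth phi_proper pc xstar_min Fe).
    exact: (phi_iterate_fin phi_proper x_algo).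
  rewrite sqdistE// lee_fin -D0E.
  have aml : 0 < a * (mu + 2 * lambda) by rewrite mulr_gt0.
  have -> : theta * beta * a / (mu + 2 * lambda)
    = theta * beta * a ^+ 2 / (1 + a * (mu + 2 * lambda) - 1).
    by field; rewrite !gt_eqF// addrC addKr.
  apply: rate_contraction; first by rewrite ltrDl.
    by rewrite mulr_ge0// sqr_ge0.
  move=> k kK; have := step' k kK; rewrite (aE (Ordinal kK)).
  have := ler_wpM2l (ltW a0) (growth (Ordinal kK)) => /=; lra.
Qed.
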